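(* Let $M\in\mathbb{Q}^{3\times3}$ have three real eigenvalues, let $s\in\mathbb{Q}^3$, and let $T=\{x\in\mathbb{R}^3 : p(x)\sim0\}$ with $p\in\mathbb{Z}[x_1,x_2,x_3]$ and ${\sim}\in\{>,\ge\}$. Then there exist an integer $N\le 2^{\|\mathcal{I}_T\|^{c}}$, where $c$ is an absolute constant, and a set $X\subseteq\{0,1\}$, computable from $M,s,p$, such that for all $n>N$: $M^ns\in T$ if and only if $n \bmod 2\in X$.
   Context: $\|\mathcal{I}_T\|=\|p\|+\|M\|+\|s\|$, where $\|M\|,\|s\|$ are bit lengths of the binary encodings of the rational entries and $\|p\|$ is the bit length of the list of integer coefficients of $p$ (including zeros). *)

(* Defs.v *)
From HB Require Import structures.
From mathcomp Require Export all_boot all_order all_algebra.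
From mathcomp Require Export reals.
From mathcomp Require Export mpoly.

Set Implicit Arguments.
Unset Strict Implicit.
Unset Printing Implicit Defensive.

Import GRing.Theory Num.Theory.

Local Open Scope ring_scope.

(** * Total recursive functions

   Smallest class of total functions nat^k -> nat containing the constants 0,
   successor and the projections, and closed under composition, primitive
   recursion and minimization of regular functions.  The last two clauses are
   relational: [f] is any function satisfying the recursion equations,
   respectively returning the least zero of [g]. *)
Inductive recursive : forall k : nat, (k.-tuple nat -> nat) -> Prop :=
| recursive_zero k : recursive (fun _ : k.-tuple nat => 0%N)
| recursive_succ : recursive (fun t : 1.-tuple nat => (thead t).+1)
| recursive_proj k (i : 'I_k) : recursive (fun t : k.-tuple nat => tnth t i)
| recursive_comp k m (g : m.-tuple nat -> nat)
    (f : 'I_m -> k.-tuple nat -> nat) :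
    recursive g -> (forall i, recursive (f i)) ->
    recursive (fun t : k.-tuple nat => g [tuple f i t | i < m])
| recursive_primrec k (g : k.-tuple nat -> nat) (h : k.+2.-tuple nat -> nat)
    (f : k.+1.-tuple nat -> nat) :
    recursive g -> recursive h ->
    (forall t : k.-tuple nat, f [tuple of 0%N :: t] = g t) ->
    (forall (n : nat) (t : k.-tuple nat),
      f [tuple of n.+1 :: t] = h [tuple of n :: f [tuple of n :: t] :: t]) ->
    recursive f
| recursive_min k (g : k.+1.-tuple nat -> nat) (f : k.-tuple nat -> nat) :
    recursive g ->
    (forall t : k.-tuple nat, g [tuple of f t :: t] = 0%N) ->
    (forall (t : k.-tuple nat) (n : nat),
      (n < f t)%N -> g [tuple of n :: t] <> 0%N) ->
    recursive f.

(** * The list of coefficients of a polynomial *)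

(* All (i, j, k) with i + j + k < d, in lexicographic order. *)
Definition monomials3 (d : nat) : seq 'X_{1..3} :=
  flatten [seq [seq [multinom of [:: i; j; k]] | j <- iota 0 (d - i),
                                                 k <- iota 0 (d - i - j)]
          | i <- iota 0 d].

(* [msize p] is the total degree plus one, so the list runs over all monomials
   of degree at most deg p, with their possibly zero coefficients. *)
Definition coefs (p : {mpoly int[3]}) : seq int :=
  [seq p@_m | m <- monomials3 (msize p)].

(** * Bit lengths *)

(* Number of binary digits; 0 is written with one digit. *)
Definition nat_bits (n : nat) : nat := (trunc_log 2 n).+1.

(* One more bit for the sign. *)
Definition int_bits (z : int) : nat := (nat_bits `|z|).+1.

Definition rat_bits (q : rat) : nat := (int_bits (numq q) + nat_bits `|denq q|)%N.

Definition mx_bits (m n : nat) (A : 'M[rat]_(m, n)) : nat :=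
  (\sum_i \sum_j rat_bits (A i j))%N.

Definition mpoly_bits (p : {mpoly int[3]}) : nat :=
  (\sum_(z <- coefs p) int_bits z)%N.

Definition instance_bits
    (M : 'M[rat]_3) (s : 'cV[rat]_3) (p : {mpoly int[3]}) : nat :=
  (mpoly_bits p + mx_bits M + mx_bits s)%N.

(** * Computability of a set of parities from an instance *)

Definition int_code (z : int) : nat :=
  match z with Posz n => n.*2 | Negz n => n.*2.+1 end.

Definition rat_code (q : rat) : seq nat :=
  [:: int_code (numq q); int_code (denq q)].

Definition mx_code (m n : nat) (A : 'M[rat]_(m, n)) : seq nat :=
  flatten [seq rat_code (A i j) | i <- enum 'I_m, j <- enum 'I_n].

(* The two matrices have fixed formats, so no separators are needed;
   [CodeSeq.code] is a bijection from [seq nat] to [nat]. *)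
Definition instance_code
    (M : 'M[rat]_3) (s : 'cV[rat]_3) (p : {mpoly int[3]}) : nat :=
  CodeSeq.code (mx_code M ++ mx_code s ++ [seq int_code z | z <- coefs p]).

Definition parities_code (X : {set 'I_2}) : nat := (\sum_(i in X) 2 ^ i)%N.

Definition computable
    (X : 'M[rat]_3 -> 'cV[rat]_3 -> {mpoly int[3]} -> {set 'I_2}) : Prop :=
  exists2 f : 1.-tuple nat -> nat, recursive f &
    forall M s p, f [tuple instance_code M s p] = parities_code (X M s p).

(** * Eigenvalues and the target set *)

(* Eigenvalues are counted with algebraic multiplicity. *)
Definition three_real_eigenvalues (R : realType) (M : 'M[rat]_3) : Prop :=
  exists l : 'I_3 -> R,
    char_poly (map_mx ratr M : 'M[R]_3) = \prod_(i < 3) ('X - (l i)%:P).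

Variant sign_cond := Gt0 | Ge0.

Definition target (R : realType) (p : {mpoly int[3]}) (r : sign_cond) :
    {pred 'cV[R]_3} :=
  [pred x : 'cV[R]_3 |
    let px : R := (map_mpoly intr p).@[fun i => x i 0] in
    match r with Gt0 => 0 < px | Ge0 => 0 <= px end].
Arguments target : clear implicits.

(* Main.v *)
(** Scale [M] to an integer matrix with real eigenvalues [mu_j], and fix the
    parity of the exponent, so that only the non-negative numbers [mu_j ^ 2]
    matter.  Solving the recurrence given by Cayley-Hamilton and expanding the
    polynomial, [p(M ^ n s)] is, up to a factor of constant sign, a sum of terms
    [F(mu) * m ^ k * E(mu) ^ m] with integer polynomials [F], [E].  The product
    of the non-zero conjugates of an algebraic integer [F(mu)] is a non-zero
    integer, so a non-zero [F(mu)], or a difference of two bases [E(mu)], is at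
    least an inverse power of the common bound on its conjugates.  Hence past
    an explicit point, of polynomial bit length, the dominant non-zero term
    fixes the sign.  The number of terms is exponential, but only its logarithm
    enters the bound.

    The parity set is therefore read off by testing the sign at one exponent of
    each parity past the bound, in exact rational arithmetic; this computation
    is shown to be recursive by coding pairs and lists into natural numbers. *)

From HB Require Import structures.
Require Import Defs.
From mathcomp Require boolp.
From mathcomp Require Import fingroup perm archimedean lra ring zify.

Set Implicit Arguments.
Unset Strict Implicit.
Unset Printing Implicit Defensive.

Import Order.TTheory GRing.Theory Num.Theory.

Local Open Scope ring_scope.

(** * Integer polynomials in the roots of an integer polynomial *)

(** A real number does not know its conjugates, so every quantity is carried as an integer
    polynomial in the roots, and its conjugates are the values at [mu \o s] for all permutations
    [s]. The whole symmetric group stands in for the Galois group, which allows reducible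
    polynomials and repeated roots alike; the price is the exponent $n!-1$ in the lower bounds, here
    5. Solving the recurrence divides by differences of roots, and squaring can make distinct
    eigenvalues coincide. Each pattern of coincidences gets one multiplier, common to all
    coordinates, that clears the denominators; homogenizing [p] then gives every monomial the same
    power of it. Its sign may be unknown but does not depend on the exponent of the matrix. Only the
    existence of a limiting sign is proved: which coefficients vanish is settled by case distinction
    and never computed, so no arithmetic on algebraic numbers enters the algorithm. *)

Definition ieval (R : comNzRingType) n (v : 'I_n -> R) : {mpoly int[n]} -> R :=
  mmap intr v.

HB.instance Definition _ (R : comNzRingType) n (v : 'I_n -> R) :=
  GRing.RMorphism.on (ieval v).

Lemma ievalX (R : comNzRingType) n (v : 'I_n -> R) i : ieval v 'X_i = v i.
Proof. by rewrite /ieval mmapX mmap1U. Qed.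

Lemma ievalC (R : comNzRingType) n (v : 'I_n -> R) (c : int) :
  ieval v c%:MP = c%:~R.
Proof. by rewrite /ieval mmapC. Qed.

Lemma eq_ieval (R : comNzRingType) n (v w : 'I_n -> R) F :
  v =1 w -> ieval v F = ieval w F.
Proof.
move=> vw; rewrite /ieval /mmap; apply: eq_bigr => m _.
by rewrite (mmap1_eq _ vw).
Qed.

Lemma mmap_ieval (R : comNzRingType) n k (v : 'I_n -> R)
    (h : 'I_k -> {mpoly int[n]}) (F : {mpoly int[k]}) :
  ieval v (mmap (@mpolyC n int) h F) = ieval (fun i => ieval v (h i)) F.
Proof.
rewrite {2}/ieval /mmap rmorph_sum /=; apply: eq_bigr => m _.
rewrite rmorphM /= ievalC /mmap1 rmorph_prod /=; congr (_ * _).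
by apply: eq_bigr => i _; rewrite rmorphXn.
Qed.

Lemma ieval_msym (R : comNzRingType) n (v : 'I_n -> R) (s : 'S_n) F :
  ieval v (msym s F) = ieval (v \o s) F.
Proof. by rewrite mmap_ieval; apply: eq_ieval => i; rewrite ievalX. Qed.

Lemma ieval_Num_int (R : archiRealFieldType) n (v : 'I_n -> R) F :
  (forall i, v i \is a Num.int) -> ieval v F \is a Num.int.
Proof.
move=> vZ; rewrite /ieval /mmap; apply: rpred_sum => m _.
by apply: rpredM; [exact: intr_int | apply: rpred_prod => i _; apply: rpredX].
Qed.

(** * Lower bounds for non-zero values at the roots *)

Section Norm.
Variables (R : archiRealFieldType) (n : nat) (mu : 'I_n -> R) (q : {poly int}).
Hypothesis muE : \prod_(i < n) ('X - (mu i)%:P) = map_poly intr q.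

(** The fundamental theorem writes [F] as an integer polynomial in the elementary symmetric
    polynomials, whose values at the roots are, up to sign, coefficients of [q]. *)
Lemma ieval_symmetric F : F \is symmetric -> ieval mu F \is a Num.int.
Proof.
move=> /sym_fundamental [t [<- _]].
rewrite /comp_mpoly mmap_ieval; apply: ieval_Num_int => i.
rewrite tnth_mktuple.
have lt_i : (i.+1 < n.+1)%N by rewrite ltnS.
have := mroots_coeff [tuple mu j | j < n] (Ordinal lt_i).
rewrite big_tuple (eq_bigr (fun j => 'X - (mu j)%:P)); last first.
  by move=> j _; rewrite tnth_mktuple.
rewrite muE coef_map /= => /(congr1 ( *%R ((-1) ^+ i.+1))).
rewrite signrMK.
suff -> : (mesym n R i.+1).@[tnth [tuple mu j | j < n]] =
          ieval mu (mesym n int i.+1).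
  by move=> <-; rewrite rpredMsign intr_int.
rewrite /mesym rmorph_sum /= raddf_sum /=; apply: eq_bigr => A _.
rewrite !rmorph_prod /=; apply: eq_bigr => j _.
by rewrite ievalX mevalXU tnth_mktuple.
Qed.

(* The product of the non-zero conjugates of [F(mu)] is, up to sign, the lowest
   non-zero coefficient of a monic integer polynomial. *)
Lemma conjugates_prod_ge1 (F : {mpoly int[n]}) :
  1 <= \prod_(s : 'S_n | ieval (mu \o s) F != 0) `|ieval (mu \o s) F|.
Proof.
pose P : {poly {mpoly int[n]}} := \prod_(s : 'S_n) ('X - (msym s F)%:P).
have P_sym k : P`_k \is symmetric.
  apply/issymP => t.
  suff {2}-> : P = map_poly (msym t) P by rewrite coef_map.
  rewrite /P rmorph_prod /= (reindex_inj (mulIg t)) /=; apply: eq_bigr => s _.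
  by rewrite rmorphB /= map_polyX map_polyC /= msymMm.
pose Q := map_poly (ieval mu) P.
have Q_int k : Q`_k \is a Num.int by rewrite coef_map ieval_symmetric.
pose c (s : 'S_n) := ieval (mu \o s) F.
have QE : Q = \prod_(s : 'S_n) ('X - (c s)%:P).
  rewrite /Q /P rmorph_prod /=; apply: eq_bigr => s _.
  by rewrite rmorphB /= map_polyX map_polyC /= ieval_msym.
(* The [k] vanishing conjugates contribute the factor $X^k$ to [Q], so its [k]-th coefficient is the
   constant coefficient of the product of the other factors. *)
pose k := #|[pred s : 'S_n | c s == 0]|.
have Qk : Q`_k = \prod_(s : 'S_n | c s != 0) - c s.
  rewrite QE (bigID (fun s : 'S_n => c s == 0)) /=.
  rewrite (eq_bigr (fun _ => 'X)); last first.
    by move=> s /eqP ->; rewrite subr0.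
  rewrite prodr_const -/k coefXnM ltnn subnn -horner_coef0 horner_prod.
  by apply: eq_bigr => s _; rewrite !hornerE.
rewrite (eq_bigr (fun s => `|- c s|)); last by move=> s _; rewrite normrN.
rewrite -normr_prod -Qk norm_intr_ge1 // Qk.
by apply/prodf_neq0 => s; rewrite oppr_eq0.
Qed.

(** The other $n!-1$ factors of a product that is at least 1 are bounded by [B]. Vanishing
    conjugates are absent from that product; [1 <= B] lets [B] be counted for them as well. *)
Lemma ieval_lower_bound (F : {mpoly int[n]}) (B : R) :
  1 <= B -> (forall s : 'S_n, `|ieval (mu \o s) F| <= B) ->
  ieval mu F != 0 -> 1 <= `|ieval mu F| * B ^+ (n`!).-1.
Proof.
move=> B1 leB nz; have := conjugates_prod_ge1 F.
have B0 : 0 <= B by apply: le_trans B1.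
have ieval1 : ieval (mu \o (1%g : 'S_n)) F = ieval mu F.
  by apply: eq_ieval => i; rewrite /= perm1.
rewrite (bigD1 (1%g : 'S_n)) /= ieval1 //=.
move=> /le_trans; apply; apply: ler_wpM2l => //.
apply: (@le_trans _ _ (\prod_(s : 'S_n | s != 1%g) B)).
  rewrite [leRHS](bigID (fun s : 'S_n => ieval (mu \o s) F != 0)) /=.
  rewrite -[leLHS]mulr1; apply: ler_pM => //.
  - by apply: prodr_ge0.
  - rewrite [leLHS](eq_bigl (fun s : 'S_n =>
      (s != 1%g) && (ieval (mu \o s) F != 0))); last by move=> s; rewrite andbC.
    by apply: ler_prod => s _; rewrite normr_ge0 leB.
  - by rewrite prodr_const exprn_ege1.
rewrite prodr_const; suff -> : #|(fun s : 'S_n => s != 1%g)| = (n`!).-1 by [].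
by have := cardC1 (1%g : 'S_n); rewrite -card_Sn.
Qed.

End Norm.

(** * Sums of exponential terms and their eventual sign *)

Section Growth.
Variable R : realFieldType.
Implicit Types (d T H G x y : R).

Lemma bernoulli d q : 0 <= d -> 1 + q%:R * d <= (1 + d) ^+ q.
Proof.
move=> d0; elim: q => [|q IH]; first by rewrite mul0r addr0 expr0.
rewrite exprS; apply: (@le_trans _ _ ((1 + d) * (1 + q%:R * d))).
  have := mulr_ge0 (mulr_ge0 (ler0n R q) d0) d0.
  by rewrite -natr1; lra.
by apply: ler_wpM2l => //; lra.
Qed.

(** Cut [m] into [a] $=2(K+1)$ blocks of length [q]. Bernoulli on a block gives $(1+1/T)^{qa} \ge
    ((1+q/T)^2)^{K+1}$, and $(q/T)^2 \ge m$ because rounding costs at most a factor 2, so that $q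
    \ge m/(4(K+1))$; the square of this 4 is the constant 16. *)
Lemma exp_beats_power T K m : 1 <= T ->
  16 * K.+1%:R ^+ 2 * T ^+ 2 <= m%:R -> m%:R ^+ K.+1 <= (1 + T^-1) ^+ m.
Proof.
move=> T1 le_m; have T0 : 0 < T by lra.
have d0 : 0 < T^-1 by rewrite invr_gt0.
pose a := (2 * K.+1)%N; pose q := (m %/ a)%N.
have KR1 : 1 <= K.+1%:R :> R by rewrite ler1n.
have aE : a%:R = 2 * K.+1%:R :> R by rewrite /a natrM.
have T2 : 1 <= T ^+ 2 by rewrite exprn_ege1.
have le_am : (a <= m)%N by rewrite -(ler_nat R) aE; nra.
have le_mq : (m <= 2 * (q * a))%N.
  have a0 : (0 < a)%N by rewrite muln_gt0.
  have q1 : (0 < q)%N by rewrite divn_gt0.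
  have := divn_eq m a; have := ltn_pmod m a0; rewrite -/q; nia.
have le_mqR : m%:R <= 4 * q%:R * K.+1%:R :> R.
  move: le_mq; rewrite -(ler_nat R) natrM natrM aE => /le_trans; apply.
  by rewrite le_eqVlt; apply/orP; left; apply/eqP; ring.
have m0 : 0 < m%:R :> R by rewrite (lt_le_trans _ le_m) //; nra.
have q0 : 0 <= q%:R :> R by [].
have le_mqd : m%:R <= (1 + q%:R * T^-1) ^+ 2.
  have mT : m%:R * T ^+ 2 <= q%:R ^+ 2.
    have h1 : m%:R * (16 * K.+1%:R ^+ 2 * T ^+ 2) <= m%:R ^+ 2 :> R.
      by rewrite expr2 ler_wpM2l // ltW.
    have h2 : m%:R ^+ 2 <= (4 * q%:R * K.+1%:R) ^+ 2 :> R.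
      by rewrite ler_sqr ?nnegrE // !mulr_ge0.
    have h3 := le_trans h1 h2.
    have KR2 : 0 < 16 * K.+1%:R ^+ 2 :> R by nra.
    by rewrite -(ler_pM2l KR2); lra.
  apply: (@le_trans _ _ ((q%:R * T^-1) ^+ 2)); last first.
    by rewrite ler_sqr ?nnegrE ?addr_ge0 ?mulr_ge0 ?ler_wpDl // ltW.
  by rewrite exprMn exprVn ler_pdivlMr // exprn_gt0.
apply: (@le_trans _ _ ((1 + q%:R * T^-1) ^+ a)).
  by rewrite /a exprM lerXn2r ?nnegrE ?exprn_ge0 ?addr_ge0 ?mulr_ge0 // ltW.
apply: (@le_trans _ _ ((1 + T^-1) ^+ (q * a))).
  have d0' := ltW d0.
  rewrite exprM lerXn2r ?nnegrE ?exprn_ge0 ?addr_ge0 ?mulr_ge0 //.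
  by rewrite bernoulli.
by rewrite ler_weXn2l // ?leq_trunc_div //; lra.
Qed.

(** A gap of at least $1/G$ below [H] is a ratio of at least $1+1/(HG)$; the inequality is kept in
    product form because [x] may be 0. *)
Lemma exp_gap_beats_power H G x y K m :
  1 <= H -> 1 <= G -> 0 <= x -> x < y -> y <= H -> 1 <= (y - x) * G ->
  16 * K.+1%:R ^+ 2 * (H * G) ^+ 2 <= m%:R ->
  m%:R ^+ K.+1 * x ^+ m <= y ^+ m.
Proof.
move=> H1 G1 x0 xy yH gap le_m.
have HG1 : 1 <= H * G by rewrite mulr_ege1.
have HG0 : 0 < H * G by lra.
have d0 : 0 < (H * G)^-1 by rewrite invr_gt0.
apply: (@le_trans _ _ ((1 + (H * G)^-1) ^+ m * x ^+ m)).
  by rewrite ler_wpM2r ?exprn_ge0 // exp_beats_power.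
rewrite -exprMn lerXn2r ?nnegrE ?mulr_ge0 //; try lra.
rewrite -(ler_pM2r HG0) mulrAC mulrDl mul1r mulVf ?gt_eqF //.
have : 0 <= (H - x) * ((y - x) * G - 1) by rewrite mulr_ge0; lra.
have : 0 <= (y - x) * G * x by rewrite !mulr_ge0; lra.
nra.
Qed.

Lemma sgr_dominant (x y : R) : `|y| < `|x| -> Num.sg (x + y) = Num.sg x.
Proof.
move=> lt_yx; have [x0|x0|x0] := ltrgt0P x.
- rewrite !gtr0_sg //; move: lt_yx; rewrite (gtr0_norm x0) ltr_norml; lra.
- rewrite !ltr0_sg //; move: lt_yx; rewrite (ltr0_norm x0) ltr_norml; lra.
- by move: lt_yx; rewrite x0 normr0 ltNge normr_ge0.
Qed.

End Growth.

(** * Exponential sums with bounded conjugates *)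

Section ExpSum.
Variables (R : archiRealFieldType) (n : nat) (mu : 'I_n -> R).
Implicit Types (F G E : {mpoly int[n]}) (W H : R) (u v : nat -> R).

(** The analogue of the house of an algebraic integer, over all permutations of the roots. It
    belongs to the polynomial and not to the value at [mu]. *)
Definition cnorm F : R := \big[Num.max/0]_(s : 'S_n) `|ieval (mu \o s) F|.

Lemma cnorm_ge F (s : 'S_n) : `|ieval (mu \o s) F| <= cnorm F.
Proof. exact: le_bigmax. Qed.

Lemma cnorm_ge0 F : 0 <= cnorm F.
Proof. exact: bigmax_ge_id. Qed.

Lemma cnorm_le F B :
  0 <= B -> (forall s : 'S_n, `|ieval (mu \o s) F| <= B) -> cnorm F <= B.
Proof. by move=> B0 leB; apply: bigmax_le. Qed.

Lemma ieval_cnorm F : `|ieval mu F| <= cnorm F.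
Proof.
suff -> : ieval mu F = ieval (mu \o (1%g : 'S_n)) F by exact: cnorm_ge.
by apply: eq_ieval => i; rewrite /= perm1.
Qed.

Lemma cnormD F G : cnorm (F + G) <= cnorm F + cnorm G.
Proof.
apply: cnorm_le => [|s]; first by rewrite addr_ge0 ?cnorm_ge0.
by rewrite rmorphD (le_trans (ler_normD _ _)) // lerD ?cnorm_ge.
Qed.

Lemma cnormN F : cnorm (- F) = cnorm F.
Proof. by apply: eq_bigr => s _; rewrite rmorphN normrN. Qed.

Lemma cnormB F G : cnorm (F - G) <= cnorm F + cnorm G.
Proof. by rewrite -(cnormN G) cnormD. Qed.

Lemma cnormM F G : cnorm (F * G) <= cnorm F * cnorm G.
Proof.
apply: cnorm_le => [|s]; first by rewrite mulr_ge0 ?cnorm_ge0.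
by rewrite rmorphM normrM ler_pM ?cnorm_ge.
Qed.

Lemma cnormC (c : int) : cnorm c%:MP <= `|c|%:~R.
Proof. by apply: cnorm_le => [|s]; rewrite ?ler0z // ievalC intr_norm. Qed.

Lemma cnormX i B : (forall j, `|mu j| <= B) -> cnorm 'X_i <= B.
Proof.
move=> leB; apply: cnorm_le => [|s]; last by rewrite ievalX /=.
exact: le_trans (leB i).
Qed.

Lemma cnorm_sum (I : Type) (r : seq I) (P : pred I) (F : I -> {mpoly int[n]}) :
  cnorm (\sum_(i <- r | P i) F i) <= \sum_(i <- r | P i) cnorm (F i).
Proof.
elim/big_ind2: _ => [|a x b y lea leb|//].
  by apply: cnorm_le => // s; rewrite rmorph0 normr0.
by apply: le_trans (lerD lea leb); exact: cnormD.
Qed.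

(* [(F, k, E)] stands for the sequence [m |-> F(mu) * m ^ k * E(mu) ^ m]. *)
Definition exp_term := ({mpoly int[n]} * nat * {mpoly int[n]})%type.

Definition term_coef (t : exp_term) : R := ieval mu t.1.1.
Definition term_base (t : exp_term) : R := ieval mu t.2.
Definition term_val (t : exp_term) (m : nat) : R :=
  term_coef t * m%:R ^+ t.1.2 * term_base t ^+ m.

Definition term_ok (K : nat) H (t : exp_term) : bool :=
  [&& (t.1.2 <= K)%N, 0 <= term_base t & cnorm t.2 <= H].

Definition weight (L : seq exp_term) : R := \sum_(t <- L) cnorm t.1.1.

Definition expsum W (K : nat) H u : Prop :=
  exists2 L : seq exp_term, (forall m, u m = \sum_(t <- L) term_val t m) &
    weight L <= W /\ all (term_ok K H) L.

Lemma weight_ge0 L : 0 <= weight L.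
Proof. by apply: sumr_ge0 => t _; exact: cnorm_ge0. Qed.

Lemma expsum_le W W' K K' H H' u :
  W <= W' -> (K <= K')%N -> H <= H' -> expsum W K H u -> expsum W' K' H' u.
Proof.
move=> leW leK leH [L uE [wL okL]]; exists L => //; split.
  exact: le_trans wL leW.
apply: sub_all okL => t /and3P[tK t0 tH].
by rewrite /term_ok (leq_trans tK) // t0 (le_trans tH).
Qed.

Lemma eq_expsum W K H u v : u =1 v -> expsum W K H u -> expsum W K H v.
Proof. by move=> uv [L uE ?]; exists L => // m; rewrite -uv. Qed.

Lemma expsum0 K H : expsum 0 K H (fun=> 0).
Proof. by exists [::] => [m|]; rewrite /weight big_nil. Qed.

Lemma expsum_term F k E W K H :
  cnorm F <= W -> (k <= K)%N -> 0 <= ieval mu E -> cnorm E <= H ->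
  expsum W K H (fun m => ieval mu F * m%:R ^+ k * ieval mu E ^+ m).
Proof.
move=> FW kK E0 EH; exists [:: (F, k, E)] => [m|].
  by rewrite big_seq1.
by rewrite /weight big_seq1 /= /term_ok /= kK EH /term_base /= E0.
Qed.

Lemma expsumD W1 W2 K H u v :
  expsum W1 K H u -> expsum W2 K H v ->
  expsum (W1 + W2) K H (fun m => u m + v m).
Proof.
move=> [L uE [wL okL]] [L' vE [wL' okL']]; exists (L ++ L') => [m|].
  by rewrite big_cat /= uE vE.
by rewrite /weight big_cat all_cat okL okL' lerD.
Qed.

Lemma expsum_sum (I : eqType) (r : seq I) K H (W : I -> R) (u : I -> nat -> R) :
  (forall i, i \in r -> expsum (W i) K H (u i)) ->
  expsum (\sum_(i <- r) W i) K H (fun m => \sum_(i <- r) u i m).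
Proof.
elim: r => [|i r IH] ex_u.
  by rewrite big_nil; apply: eq_expsum (expsum0 K H) => m; rewrite big_nil.
have ex_i : expsum (W i) K H (u i) by apply: ex_u; rewrite inE eqxx.
have ex_r : expsum (\sum_(i <- r) W i) K H (fun m => \sum_(i <- r) u i m).
  by apply: IH => j jr; apply: ex_u; rewrite inE jr orbT.
rewrite big_cons; apply: eq_expsum (expsumD ex_i ex_r) => m.
by rewrite big_cons.
Qed.

Lemma expsum_int (z : int) : expsum `|z|%:~R 0 1 (fun=> z%:~R).
Proof.
have c1 : cnorm 1 <= 1 by have := cnormC 1; rewrite mpolyC1.
have ge0 : 0 <= ieval mu 1 by rewrite rmorph1.
apply: eq_expsum (expsum_term (cnormC z) (leqnn 0) ge0 c1) => m.
by rewrite ievalC rmorph1 expr1n !mulr1.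
Qed.

Lemma expsumM W1 W2 K1 K2 H1 H2 u v :
  expsum W1 K1 H1 u -> expsum W2 K2 H2 v ->
  expsum (W1 * W2) (K1 + K2) (H1 * H2) (fun m => u m * v m).
Proof.
move=> [L uE [wL okL]] [L' vE [wL' okL']].
pose mul (t t' : exp_term) : exp_term :=
  (t.1.1 * t'.1.1, (t.1.2 + t'.1.2)%N, t.2 * t'.2).
exists [seq mul t t' | t <- L, t' <- L'] => [m|].
  rewrite uE vE big_allpairs_dep /= mulr_suml; apply: eq_bigr => t _.
  rewrite mulr_sumr; apply: eq_bigr => t' _.
  by rewrite /term_val /term_coef /term_base /= !rmorphM exprD exprMn; ring.
split.
  apply: (@le_trans _ _ (weight L * weight L')); last first.
    by rewrite ler_pM ?weight_ge0.
  rewrite /weight big_allpairs_dep /= mulr_suml; apply: ler_sum => t _.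
  by rewrite mulr_sumr; apply: ler_sum => t' _; exact: cnormM.
apply/allP => _ /allpairsP[[t t'] /= [/(allP okL) okt /(allP okL') okt' ->]].
case/and3P: okt => tK t0 tH; case/and3P: okt' => tK' t0' tH'.
rewrite /term_ok /term_base /= rmorphM mulr_ge0 // leq_add //=.
by apply: le_trans (cnormM _ _) _; rewrite ler_pM ?cnorm_ge0.
Qed.

Lemma expsumX W K H u d :
  expsum W K H u -> expsum (W ^+ d) (K * d) (H ^+ d) (fun m => u m ^+ d).
Proof.
move=> ex_u; elim: d => [|d IH].
  by rewrite muln0; apply: eq_expsum (expsum_int 1) => m.
rewrite mulnS !exprS; apply: eq_expsum (expsumM ex_u IH) => m.
by rewrite exprS.
Qed.

Variable q : {poly int}.
Hypothesis muE : \prod_(i < n) ('X - (mu i)%:P) = map_poly intr q.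
Let e := (n`!).-1.

(** The order is lexicographic, base before power of [m], which is the order of growth for positive
    bases. *)
Lemma max_term (L : seq exp_term) : L != [::] ->
  exists2 t, t \in L & forall t', t' \in L -> term_base t' < term_base t \/
    term_base t' = term_base t /\ (t'.1.2 <= t.1.2)%N.
Proof.
elim: L => [//|t [|t' L] IH] _.
  by exists t => [|t']; rewrite inE // => /eqP ->; right.
have [//|x xL maxx] := IH.
have [lt_xt|lt_tx|eq_xt] := ltgtP (term_base x) (term_base t).
- exists t => [|y]; first by rewrite inE eqxx.
  rewrite inE => /orP[/eqP ->|/maxx [lt_yx|[-> _]]]; first by right.
  + by left; apply: lt_trans lt_xt.
  + by left.
- exists x => [|y]; first by rewrite inE xL orbT.
  by rewrite inE => /orP[/eqP ->|/maxx //]; left.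
- have [le_k|lt_k] := leqP t.1.2 x.1.2.
  + exists x => [|y]; first by rewrite inE xL orbT.
    by rewrite inE => /orP[/eqP ->|/maxx //]; right.
  + exists t => [|y]; first by rewrite inE eqxx.
    rewrite inE => /orP[/eqP ->|/maxx [lt_yx|[-> le_k]]]; first by right.
    * by left; rewrite -eq_xt.
    * by right; split => //; apply: leq_trans (ltnW lt_k).
Qed.

(** The second clause makes [m] outweigh the ratio of the total weight [W] to a leading coefficient,
    which is at least $W^{-e}$. The third is the threshold of [exp_gap_beats_power] for the gap
    $(2H)^{-e}$, since a difference of two bases has conjugates of size at most $2H$. *)
Definition past (W : R) (K : nat) (H : R) (m : nat) : Prop :=
  [/\ (0 < m)%N, W ^+ e.+1 < m%:R
    & 16 * K.+1%:R ^+ 2 * (H * (2 * H) ^+ e) ^+ 2 <= m%:R].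

(** For equal bases the spare factor [m] comes from the lower power. Otherwise the difference of the
    bases is a non-zero value at the roots, hence bounded below, and the exponential gap absorbs
    $m^{K+1}$. *)
Lemma dominated_term W K H t t' m :
  1 <= H -> past W K H m -> term_ok K H t -> term_ok K H t' ->
  0 < term_base t ->
  term_base t' < term_base t \/
    term_base t' = term_base t /\ (t'.1.2 < t.1.2)%N ->
  m%:R * (m%:R ^+ t'.1.2 * term_base t' ^+ m) <=
    m%:R ^+ t.1.2 * term_base t ^+ m.
Proof.
move=> H1 [m0 _ le_m] /and3P[tK _ tH] /and3P[tK' t0' tH'] t0.
have m1 : 1 <= m%:R :> R by rewrite ler1n.
have t0w := ltW t0.
rewrite mulrA -exprS => -[lt_tt|[-> lt_k]]; last first.
  by rewrite ler_wpM2r ?exprn_ge0 // ler_weXn2l.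
apply: (@le_trans _ _ (m%:R ^+ K.+1 * term_base t' ^+ m)).
  by rewrite ler_wpM2r ?exprn_ge0 // ler_weXn2l.
apply: (@le_trans _ _ (term_base t ^+ m)); last first.
  by rewrite ler_peMl ?exprn_ge0 ?exprn_ege1.
have H21 : 1 <= 2 * H by lra.
apply: (@exp_gap_beats_power _ H ((2 * H) ^+ e)) => //.
- by rewrite exprn_ege1.
- by apply: le_trans tH; apply: le_trans (ieval_cnorm _); exact: ler_norm.
- have gtE : ieval mu (t.2 - t'.2) = term_base t - term_base t'.
    by rewrite rmorphB.
  have gt0 : 0 < term_base t - term_base t' by rewrite subr_gt0.
  rewrite -(gtr0_norm gt0) -gtE; apply: (ieval_lower_bound muE) => //.
    move=> s; apply: le_trans (cnorm_ge _ _) _.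
    by apply: le_trans (cnormB _ _) _; lra.
  by rewrite gtE gt_eqF.
Qed.

(** Induction on the number of terms: the terms of maximal growth are merged; either their
    coefficients cancel and the group is dropped, or it decides the sign. *)
Lemma sum_sign_stable W K H (L : seq exp_term) :
  1 <= W -> 1 <= H -> weight L <= W -> all (term_ok K H) L ->
  all (fun t => 0 < term_base t) L ->
  exists x : R, forall m, past W K H m ->
    Num.sg (\sum_(t <- L) term_val t m) = x.
Proof.
move=> W1 H1; have [s] := ubnP (size L).
elim: s L => // s IH L; rewrite ltnS => leLs wL okL posL.
have [-> |L0] := eqVneq L [::].
  by exists 0 => m _; rewrite big_nil sgr0.
have [t tL maxt] := max_term L0.
(* Bases are compared by value, as different polynomials may agree at [mu]. The coefficients are
   added as polynomials, which keeps [cnorm C] within the weight. *)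
pose top (t' : exp_term) := (term_base t' == term_base t) && (t'.1.2 == t.1.2).
pose C := \sum_(t' <- L | top t') t'.1.1.
pose L' := [seq t' <- L | ~~ top t'].
have splitL m : \sum_(t' <- L) term_val t' m =
    ieval mu C * (m%:R ^+ t.1.2 * term_base t ^+ m) +
    \sum_(t' <- L') term_val t' m.
  rewrite (bigID top) /= big_filter; congr (_ + _).
  rewrite /C rmorph_sum mulr_suml; apply: eq_bigr => t' /andP[/eqP bt' /eqP kt'].
  by rewrite /term_val /term_coef bt' kt' mulrA.
have wsplit : cnorm C + weight L' <= W.
  apply: le_trans wL; rewrite /weight [leRHS](bigID top) /= big_filter lerD2r.
  exact: cnorm_sum.
have wL' : weight L' <= W by have := cnorm_ge0 C; lra.
have okL' : all (term_ok K H) L'.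
  by apply/allP => x; rewrite mem_filter => /andP[_ /(allP okL)].
have posL' : all (fun t => 0 < term_base t) L'.
  by apply/allP => x; rewrite mem_filter => /andP[_ /(allP posL)].
(* On cancellation the list is strictly shorter, since it loses at least [t], and the same [W], [K],
   [H] still bound it. *)
have [C0|C0] := eqVneq (ieval mu C) 0.
  have [|x xP] := IH L' _ wL' okL' posL'.
    apply: leq_trans leLs; rewrite size_filter -(count_predC top) -add1n.
    rewrite leq_add2r -has_count; apply/hasP; exists t => //.
    by rewrite /top !eqxx.
  by exists x => m pm; rewrite splitL C0 mul0r add0r xP.
exists (Num.sg (ieval mu C)) => m pm.
have [m0 Wm _] := pm.
have mR : 0 < m%:R :> R by rewrite ltr0n.
have bt : 0 < term_base t := allP posL t tL.
set Z := m%:R ^+ t.1.2 * term_base t ^+ m in splitL *.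
have Z0 : 0 < Z by rewrite mulr_gt0 ?exprn_gt0.
rewrite splitL sgr_dominant; first by rewrite [LHS]sgrM (gtr0_sg Z0) mulr1.
have rest : m%:R * `|\sum_(t' <- L') term_val t' m| <= W * Z.
  apply: (@le_trans _ _ (weight L' * Z)); last by rewrite ler_pM2r.
  apply: (@le_trans _ _ (m%:R * \sum_(t' <- L') `|term_val t' m|)).
    by rewrite ler_pM2l // ler_norm_sum.
  rewrite mulr_sumr mulr_suml !big_seq; apply: ler_sum => t'.
  rewrite mem_filter => /andP[ntop t'L].
  have bt' : 0 < term_base t' := allP posL t' t'L.
  have bt'w := ltW bt'.
  rewrite /term_val -mulrA normrM mulrCA (ger0_norm (mulr_ge0 _ _)) ?exprn_ge0 //.
  apply: ler_pM; rewrite ?ieval_cnorm ?mulr_ge0 ?exprn_ge0 //.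
  apply: (dominated_term H1 pm (allP okL t tL) (allP okL t' t'L) bt).
  case: (maxt t' t'L) => [?|[eb le_k]]; [by left | right; split => //].
  by rewrite ltn_neqAle le_k andbT; move: ntop; rewrite /top eb eqxx.
(* With this, [W <= |C(mu)| * W ^+ e.+1 < |C(mu)| * m], so the remainder, at most [W * Z / m], is
   smaller than the leading group. *)
have CW : 1 <= `|ieval mu C| * W ^+ e.
  apply: (ieval_lower_bound muE) => // s'; apply: le_trans (cnorm_ge _ _) _.
  by have := weight_ge0 L'; lra.
rewrite [ltRHS]normrM (gtr0_norm Z0) -(ltr_pM2l mR); apply: le_lt_trans rest _.
rewrite [ltRHS]mulrA ltr_pM2r //.
have c0 : 0 < `|ieval mu C| by rewrite normr_gt0.
apply: (@le_lt_trans _ _ (`|ieval mu C| * W ^+ e.+1)).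
  by rewrite exprSr mulrA ler_peMl //; lra.
by rewrite mulrC ltr_pM2r.
Qed.

(** Terms with base 0 vanish once [m] is positive; without them all bases are positive, as the
    domination argument requires. *)
Lemma expsum_sign_stable W K H u :
  1 <= W -> 1 <= H -> expsum W K H u ->
  exists x : R, forall m, past W K H m -> Num.sg (u m) = x.
Proof.
move=> W1 H1 [L uE [wL okL]].
pose L' := [seq t <- L | 0 < term_base t].
have [|||x xP] := @sum_sign_stable W K H L' W1 H1.
- apply: le_trans wL; rewrite /weight [leRHS](bigID (fun t => 0 < term_base t)) /=.
  by rewrite big_filter lerDl sumr_ge0 // => t _; exact: cnorm_ge0.
- by apply/allP => t; rewrite mem_filter => /andP[_ /(allP okL)].
- by apply/allP => t; rewrite mem_filter => /andP[].
exists x => m pm; rewrite -(xP m pm) uE (bigID (fun t => 0 < term_base t)) /=.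
rewrite big_filter [X in _ + X]big1_seq ?addr0 // => t /andP[].
move=> nt /(allP okL) /and3P[_ t0 _]; move: nt.
rewrite lt_neqAle t0 andbT negbK /term_val => /eqP <-.
by case: pm => m0 _ _; rewrite expr0n gtn_eqF ?mulr0.
Qed.

End ExpSum.

(** * Linear recurrences of order three *)

Section Recurrence.
Variables (R : archiRealFieldType) (n : nat) (mu : 'I_n -> R) (C : R).
Hypothesis C4 : 4 <= C.
Implicit Types (x y a b c : R).

(** Measuring sizes by the exponent of a fixed [C] turns every estimate into arithmetic on small
    numbers; [4 <= C] absorbs the integer constants and the cost of additions. *)
Definition zbounded (k : nat) x : Prop :=
  exists2 F : {mpoly int[n]}, ieval mu F = x & cnorm mu F <= C ^+ k.

Let C1 : 1 <= C. Proof. by apply: le_trans C4; rewrite ler1n. Qed.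
Let C2 : 2 <= C. Proof. by apply: le_trans C4; rewrite ler_nat. Qed.

Lemma zbounded_le k l x : (k <= l)%N -> zbounded k x -> zbounded l x.
Proof.
by move=> le_kl [F <- ?]; exists F => //; apply: le_trans (ler_weXn2l C1 le_kl).
Qed.

Lemma zboundedD k l x y :
  zbounded k x -> zbounded l y -> zbounded (maxn k l).+1 (x + y).
Proof.
move=> /(zbounded_le (leq_maxl k l)) [F <- leF].
move=> /(zbounded_le (leq_maxr k l)) [G <- leG].
exists (F + G); rewrite ?rmorphD // (le_trans (cnormD _ _ _)) //.
have Ck := exprn_ge0 (maxn k l) (le_trans ler01 C1).
have := ler_wpM2r Ck C2; rewrite exprS; move: leF leG; lra.
Qed.

Lemma zboundedN k x : zbounded k x -> zbounded k (- x).
Proof. by move=> [F <- leF]; exists (- F); rewrite ?rmorphN ?cnormN. Qed.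

Lemma zboundedM k l x y : zbounded k x -> zbounded l y -> zbounded (k + l) (x * y).
Proof.
move=> [F <- leF] [G <- leG]; exists (F * G); rewrite ?rmorphM //.
by rewrite (le_trans (cnormM _ _ _)) // exprD ler_pM ?cnorm_ge0.
Qed.

Lemma zboundedX k j x : zbounded k x -> zbounded (k * j) (x ^+ j).
Proof.
move=> zx; elim: j => [|j IH]; last by rewrite exprS mulnS; exact: zboundedM.
exists 1; rewrite ?rmorph1 // muln0 expr0.
by have := cnormC mu 1; rewrite mpolyC1.
Qed.

Lemma zbounded_int (z : int) : `|z|%:~R <= C -> zbounded 1 z%:~R.
Proof.
by exists z%:MP; rewrite ?ievalC // (le_trans (cnormC _ _)).
Qed.

Lemma zbounded_nat k : (k <= 4)%N -> zbounded 1 k%:R.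
Proof.
move=> k4; apply: (@zbounded_int k); apply: le_trans C4.
by rewrite /= ler_nat.
Qed.

Lemma zbounded_mu i : (forall j, `|mu j| <= C) -> zbounded 1 (mu i).
Proof. by exists 'X_i; rewrite ?ievalX //; apply: cnormX. Qed.

Lemma zbounded_expsum k l x y j :
  zbounded k x -> zbounded l y -> 0 <= y ->
  expsum mu (C ^+ k) j (C ^+ l) (fun m => x * m%:R ^+ j * y ^+ m).
Proof. by move=> [F <- leF] [G <- leG] y0; apply: expsum_term. Qed.

Definition rec3 a b c (x : nat -> R) : Prop :=
  forall m, x m.+3 = (a + b + c) * x m.+2 - (a * b + a * c + b * c) * x m.+1
                     + a * b * c * x m.

Lemma rec3_eq a b c (x y : nat -> R) : rec3 a b c x -> rec3 a b c y ->
  x 0%N = y 0%N -> x 1%N = y 1%N -> x 2%N = y 2%N -> x =1 y.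
Proof.
move=> rx ry e0 e1 e2 m.
suff : [/\ x m = y m, x m.+1 = y m.+1 & x m.+2 = y m.+2] by case.
by elim: m => [|m [E0 E1 E2]]; split; rewrite // rx ry E0 E1 E2.
Qed.

(** Lagrange interpolation, cleared of denominators by the Vandermonde product. The shift by 2 and
    the factors [m%:R ^+ 0] give the same shape as in the confluent cases. *)
Lemma rec3_distinct a b c (x : nat -> R) m : rec3 a b c x ->
  (a - b) * (a - c) * (b - c) * x m.+2 =
    (b - c) * (x 2%N - (b + c) * x 1%N + b * c * x 0%N) * a ^+ 2 * m%:R ^+ 0 * a ^+ m
  + (c - a) * (x 2%N - (a + c) * x 1%N + a * c * x 0%N) * b ^+ 2 * m%:R ^+ 0 * b ^+ m
  + (a - b) * (x 2%N - (a + b) * x 1%N + a * b * x 0%N) * c ^+ 2 * m%:R ^+ 0 * c ^+ m.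
Proof.
move=> rx.
pose y k := (a - b) * (a - c) * (b - c) * x k.
pose z k := (b - c) * (x 2%N - (b + c) * x 1%N + b * c * x 0%N) * a ^+ k
  - (a - c) * (x 2%N - (a + c) * x 1%N + a * c * x 0%N) * b ^+ k
  + (a - b) * (x 2%N - (a + b) * x 1%N + a * b * x 0%N) * c ^+ k.
have /(_ m.+2) : y =1 z.
  apply: (@rec3_eq a b c); rewrite /y /z.
  - by move=> k; rewrite rx; ring.
  - by move=> k; rewrite !exprS; ring.
  - ring.
  - ring.
  - ring.
by rewrite /y /z => ->; rewrite !exprS; ring.
Qed.

(* The shift of the index by 2 avoids dividing by the root [a], which may be 0. *)
Lemma rec3_double a c (x : nat -> R) m : rec3 a a c x ->
  let g := x 2%N - 2 * a * x 1%N + a ^+ 2 * x 0%N in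
  let f := (c - a) ^+ 2 * x 0%N - g in
  let h := (c - a) ^+ 2 * x 1%N - f * a - g * c in
  (c - a) ^+ 2 * x m.+2 = (f * a ^+ 2 + 2 * h * a) * m%:R ^+ 0 * a ^+ m
    + h * a * m%:R ^+ 1 * a ^+ m + g * c ^+ 2 * m%:R ^+ 0 * c ^+ m.
Proof.
move=> rx g f h.
pose y k := (c - a) ^+ 2 * x k.
(* With $S$ the shift, [g] is $(S-a)^2x$ at 0, which kills the part of the double root; [f] and [h]
   are then forced by the values at 0 and 1. The truncation of [k.-1] at 0 meets the factor 0. *)
pose z k := f * a ^+ k + h * k%:R * a ^+ k.-1 + g * c ^+ k.
have /(_ m.+2) : y =1 z.
  apply: (@rec3_eq a a c); rewrite /y /z.
  - by move=> k; rewrite rx; ring.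
  - move=> [|k] /=; rewrite ?exprS; first by ring.
    by rewrite -!natr1; ring.
  - by rewrite /f; ring.
  - by rewrite /h /=; ring.
  - by rewrite /h /f /g /=; ring.
by rewrite /y /z => ->; rewrite /= !exprS -!natr1; ring.
Qed.

Lemma rec3_triple a (x : nat -> R) m : rec3 a a a x ->
  let g := x 2%N - 2 * a * x 1%N + a ^+ 2 * x 0%N in
  let h := x 1%N - a * x 0%N in
  2 * x m.+2 = (2 * x 0%N * a ^+ 2 + 4 * h * a + 2 * g) * m%:R ^+ 0 * a ^+ m
    + (2 * h * a + 3 * g) * m%:R ^+ 1 * a ^+ m + g * m%:R ^+ 2 * a ^+ m.
Proof.
move=> rx g h.
pose y k := 2 * x k.
(* Newton's form, doubled to clear the denominator of $\binom{k}{2}$. The predecessors are truncated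
   only where the factors $k$ and $k(k-1)$ vanish. *)
pose z k := 2 * x 0%N * a ^+ k + 2 * h * k%:R * a ^+ k.-1
            + g * k%:R * (k%:R - 1) * a ^+ k.-2.
have /(_ m.+2) : y =1 z.
  apply: (@rec3_eq a a a); rewrite /y /z.
  - by move=> k; rewrite rx; ring.
  - move=> [|[|k]] /=; rewrite ?exprS; [by ring | by ring |].
    by rewrite -!natr1; ring.
  - ring.
  - by rewrite /h /=; ring.
  - by rewrite /h /g /=; ring.
by rewrite /y /z => ->; rewrite /= !exprS -!natr1; ring.
Qed.

Lemma expsum3 W K K1 K2 K3 H u v w :
  (K1 <= K)%N -> (K2 <= K)%N -> (K3 <= K)%N ->
  expsum mu (C ^+ W) K1 H u -> expsum mu (C ^+ W) K2 H v ->
  expsum mu (C ^+ W) K3 H w ->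
  expsum mu (C ^+ W.+1) K H (fun m => u m + v m + w m).
Proof.
move=> le1 le2 le3 eu ev ew.
have := expsumD (expsumD (expsum_le (lexx _) le1 (lexx _) eu)
  (expsum_le (lexx _) le2 (lexx _) ev)) (expsum_le (lexx _) le3 (lexx _) ew).
apply: expsum_le => //; rewrite exprS.
have CW := exprn_ge0 W (le_trans ler01 C1).
by have := ler_wpM2r CW C4; move: CW; lra.
Qed.

(** The exponent is left open, synthesized from the shape of the expression, and finally compared by
    computation with the required one. The value 30 used below is a rounded common bound. *)
Ltac zb := eapply zbounded_le; last (repeat first
  [ eassumption | exact: zbounded_nat | eapply zboundedD | eapply zboundedN
  | eapply zboundedM | eapply zboundedX ]); done.

Lemma rec3_expsum_double a c : zbounded 2 a -> zbounded 2 c ->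
  0 <= a -> 0 <= c -> a != c ->
  exists2 D : R, D != 0 /\ zbounded 30 D & forall x : nat -> R, rec3 a a c x ->
    zbounded 1 (x 0%N) -> zbounded 1 (x 1%N) -> zbounded 1 (x 2%N) ->
    expsum mu (C ^+ 30) 2 (C ^+ 2) (fun m => D * x m.+2).
Proof.
move=> za zc a0 c0 ac; exists ((c - a) ^+ 2).
  by split; [rewrite expf_neq0 // subr_eq0 eq_sym | zb].
move=> x rx z0 z1 z2.
apply: (@eq_expsum _ _ _ _ _ _ _ _ (fun m => esym (rec3_double m rx))).
by apply: expsum3; last (apply: zbounded_expsum => //; zb);
  last (apply: zbounded_expsum => //; zb);
  last (apply: zbounded_expsum => //; zb).
Qed.

(** [D] is chosen before the sequence, so that all coordinates of the orbit share one multiplier.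
    All coincidences of roots are treated, up to reordering the roots. *)
Lemma rec3_expsum a b c : zbounded 2 a -> zbounded 2 b -> zbounded 2 c ->
  0 <= a -> 0 <= b -> 0 <= c ->
  exists2 D : R, D != 0 /\ zbounded 30 D & forall x : nat -> R, rec3 a b c x ->
    zbounded 1 (x 0%N) -> zbounded 1 (x 1%N) -> zbounded 1 (x 2%N) ->
    expsum mu (C ^+ 30) 2 (C ^+ 2) (fun m => D * x m.+2).
Proof.
move=> za zb' zc a0 b0 c0.
have [eab|nab] := eqVneq a b; have [eac|nac] := eqVneq a c.
- subst b c; exists 2; first by split; [rewrite pnatr_eq0 | zb].
  move=> x rx z0 z1 z2.
  apply: (@eq_expsum _ _ _ _ _ _ _ _ (fun m => esym (rec3_triple m rx))).
  by apply: expsum3; last (apply: zbounded_expsum => //; zb);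
    last (apply: zbounded_expsum => //; zb);
    last (apply: zbounded_expsum => //; zb).
- by subst b; exact: rec3_expsum_double.
- subst c; have [D nD DP] := rec3_expsum_double za zb' a0 b0 nab.
  by exists D => // x rx; apply: DP => m; rewrite rx; ring.
- have [ebc|nbc] := eqVneq b c.
    subst c; have [|D nD DP] := rec3_expsum_double zb' za b0 a0 _.
      by rewrite eq_sym.
    by exists D => // x rx; apply: DP => m; rewrite rx; ring.
  exists ((a - b) * (a - c) * (b - c)).
    by split; [rewrite !mulf_neq0 // subr_eq0 | zb].
  move=> x rx z0 z1 z2.
  apply: (@eq_expsum _ _ _ _ _ _ _ _ (fun m => esym (rec3_distinct m rx))).
  by apply: expsum3; last (apply: zbounded_expsum => //; zb);
    last (apply: zbounded_expsum => //; zb);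
    last (apply: zbounded_expsum => //; zb).
Qed.

End Recurrence.

(** * The list of monomials *)

Lemma meval_map_intr (R : comNzRingType) n (v : 'I_n -> R) (p : {mpoly int[n]}) :
  (map_mpoly intr p).@[v] = ieval v p.
Proof.
rewrite /map_mpoly /ieval /mmap raddf_sum /=; apply: eq_bigr => m _.
rewrite mevalM mevalC /mmap1 rmorph_prod /=; congr (_ * _).
by apply: eq_bigr => i _; rewrite rmorphXn /= mevalXU.
Qed.

Definition mono3 (t : nat * (nat * nat)) : 'X_{1..3} :=
  [multinom of [:: t.1; t.2.1; t.2.2]].

(** The exponents of [monomials3] as plain triples of numbers, a form that the recursive algorithm
    can also produce. *)
Definition triples3 (d : nat) : seq (nat * (nat * nat)) :=
  [seq (i, jk) | i <- iota 0 d,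
     jk <- [seq (j, k) | j <- iota 0 (d - i), k <- iota 0 (d - i - j)]].

Lemma monomials3E d : monomials3 d = [seq mono3 t | t <- triples3 d].
Proof.
rewrite /triples3 map_allpairs; congr flatten; apply: eq_map => i.
by rewrite map_allpairs.
Qed.

Lemma mono3_inj : injective mono3.
Proof. by move=> [i [j k]] [i' [j' k']] [-> -> ->]. Qed.

Lemma mem_triples3 d i j k : ((i, (j, k)) \in triples3 d) = (i + j + k < d)%N.
Proof.
apply/allpairsPdep/idP => [[i' [_ [iP /allpairsPdep [j' [k' [jP kP ->]]]]]] | lt_d].
  by case=> -> -> ->; move: iP jP kP; rewrite !mem_iota; lia.
exists i, (j, k); split; rewrite ?mem_iota //; first by lia.
by apply/allpairsPdep; exists j, k; split; rewrite ?mem_iota //; lia.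
Qed.

Lemma triples3_uniq d : uniq (triples3 d).
Proof.
apply: allpairs_uniq_dep; rewrite ?iota_uniq //.
  move=> i _; apply: allpairs_uniq_dep; rewrite ?iota_uniq //.
    by move=> j _; rewrite iota_uniq.
  by move=> [j k] [j' k'] _ _ /= [-> ->].
by move=> [j k] [j' k'] _ _ /= [-> ->].
Qed.

Lemma mono3E t : [/\ mono3 t ord0 = t.1, mono3 t (inord 1) = t.2.1
                  & mono3 t (inord 2) = t.2.2].
Proof. by split; rewrite (mnm_nth 0%N) ?inordK. Qed.

Lemma mono3_eta (m : 'X_{1..3}) : mono3 (m ord0, (m (inord 1), m (inord 2))) = m.
Proof.
apply/mnmP => i; rewrite (mnm_nth 0%N).
by case: i => [[|[|[|//]]] lt_i] /=; congr (m _); apply: val_inj; rewrite /= ?inordK.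
Qed.

Lemma mdeg_mono3 t : mdeg (mono3 t) = (t.1 + t.2.1 + t.2.2)%N.
Proof. by rewrite mdegE !big_ord_recl big_ord0 addn0 addnA !(mnm_nth 0%N). Qed.

Lemma ieval_triples3 (R : comNzRingType) (v : 'I_3 -> R) (p : {mpoly int[3]}) :
  ieval v p = \sum_(t <- triples3 (msize p)) (p@_(mono3 t))%:~R *
    (v ord0 ^+ t.1 * v (inord 1) ^+ t.2.1 * v (inord 2) ^+ t.2.2).
Proof.
pose F m := (p@_m)%:~R * mmap1 v m : R.
rewrite [RHS](eq_bigr (fun t => F (mono3 t))); last first.
  move=> t _; congr (_ * _); rewrite /mmap1 !big_ord_recl big_ord0 mulr1 mulrA.
  have [<- <- <-] := mono3E t.
  have e1 : lift ord0 ord0 = inord 1 :> 'I_3 by apply: val_inj; rewrite /= inordK.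
  have e2 : lift ord0 (lift ord0 ord0) = inord 2 :> 'I_3.
    by apply: val_inj; rewrite /= inordK.
  by rewrite e1 e2.
rewrite -(big_map mono3 xpredT F) -monomials3E.
rewrite (bigID (mem (msupp p))) /= [X in _ + X]big1 ?addr0; last first.
  by move=> m; rewrite -mcoeff_eq0 /F => /eqP ->; rewrite mul0r.
rewrite -big_filter; apply: perm_big; apply: uniq_perm.
- exact: msupp_uniq.
- rewrite filter_uniq // monomials3E map_inj_uniq ?triples3_uniq //.
  exact: mono3_inj.
move=> m; rewrite mem_filter; apply/idP/andP => [mp|[]//]; split => //.
rewrite -(mono3_eta m) monomials3E mem_map; last exact: mono3_inj.
by rewrite mem_triples3 -[(_ + _)%N](mdeg_mono3 (_, (_, _))) mono3_eta msize_mdeg_lt.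
Qed.

(** Row [i.+1] of the larger list has the size of row [i] of the smaller one, and row 0 is extra.
    Strict growth lets the degree bound be recovered from the number of coefficients. *)
Lemma size_triples3S d : (size (triples3 d) < size (triples3 d.+1))%N.
Proof.
pose g e := size [seq (j, k) | j <- iota 0 e, k <- iota 0 (e - j)].
have sizeE e : size (triples3 e) = sumn [seq g (e - i)%N | i <- iota 0 e].
  by rewrite size_allpairs_dep.
rewrite !sizeE /= (iotaDl 1 0 d) -map_comp.
rewrite -[ltnLHS]add0n subn0 -[in ltnRHS](eq_map (f := fun i => g (d - i)%N)).
  by rewrite ltn_add2r.
by move=> i; rewrite /= add1n subSS.
Qed.

Lemma leq_size_triples3 d : (d <= size (triples3 d))%N.
Proof. by elim: d => // d IH; apply: leq_ltn_trans IH (size_triples3S d). Qed.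

Lemma size_triples3_mono : {mono (fun d => size (triples3 d)) : d e / (d <= e)%N}.
Proof.
by apply: leq_mono; apply: homo_ltn; [exact: ltn_trans | exact: size_triples3S].
Qed.

(** * Powers of matrices and eigenvalues *)

(** From $\det(X - dA) = d^n \det(X/d - A)$. *)
Lemma char_poly_scale (F : fieldType) n (A : 'M[F]_n) (d : F) (l : 'I_n -> F) :
  d != 0 -> char_poly A = \prod_(i < n) ('X - (l i)%:P) ->
  char_poly (d *: A) = \prod_(i < n) ('X - (d * l i)%:P).
Proof.
move=> d0 AE.
have -> : char_poly (d *: A) = d%:P ^+ n * (char_poly A \Po (d^-1 *: 'X)).
  rewrite /char_poly -[X in _ * X](det_map_mx (comp_poly (d^-1 *: 'X))) -detZ.
  congr (\det _); apply/matrixP => i j; rewrite !mxE.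
  rewrite rmorphB rmorphMn /= comp_polyC comp_polyX.
  by rewrite mulrBr mulrnAr -polyCM mul_polyC scalerA mulfV // scale1r.
rewrite AE rmorph_prod /= -[X in _ ^+ X]card_ord -prodr_const -big_split /=.
apply: eq_bigr => i _; rewrite rmorphB /= comp_polyX comp_polyC.
by rewrite mulrBr -polyCM mul_polyC scalerA mulfV // scale1r.
Qed.

(** Compare both sides of the eigenvector equation at a coordinate of largest absolute value. *)
Lemma eigenvalue_bound (R : realFieldType) n (A : 'M[R]_n.+1) (a B : R) :
  (forall i j, `|A i j| <= B) -> root (char_poly A) a -> `|a| <= n.+1%:R * B.
Proof.
move=> leB; rewrite -eigenvalue_root_char => /eigenvalueP[v vA v0].
pose k := [arg max_(k > ord0) `|v 0 k|]%O.
have maxk j : `|v 0 j| <= `|v 0 k|.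
  by rewrite /k; case: Order.TotalTheory.arg_maxP => // i _; apply.
have vk0 : 0 < `|v 0 k|.
  rewrite normr_gt0; apply: contraNneq v0 => vk0; apply/eqP/rowP => j.
  by apply/eqP; rewrite mxE -normr_le0 (le_trans (maxk j)) // vk0 normr0.
rewrite -(ler_pM2r vk0) -normrM.
have -> : a * v 0 k = \sum_j v 0 j * A j k by move/rowP: vA => /(_ k); rewrite !mxE.
apply: le_trans (ler_norm_sum _ _ _) _.
apply: (@le_trans _ _ (\sum_(j < n.+1) B * `|v 0 k|)).
  by apply: ler_sum => j _; rewrite normrM mulrC ler_pM.
by rewrite sumr_const card_ord -[leLHS]mulr_natl mulrA.
Qed.

Lemma mx_pow_bound n (A : 'M[int]_n.+1) (v : 'cV[int]_n.+1) (B V : int) k i :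
  (forall i j, `|A i j| <= B) -> (forall i, `|v i 0| <= V) ->
  `|(A ^+ k *m v) i 0| <= (n.+1%:R * B) ^+ k * V.
Proof.
move=> leB leV; elim: k i => [|k IH] i.
  by rewrite expr0 mul1mx expr0 mul1r.
have B0 : 0 <= B by apply: le_trans (leB ord0 ord0).
have V0 : 0 <= V by apply: le_trans (leV ord0).
rewrite exprS -mulmxE -mulmxA mxE; apply: le_trans (ler_norm_sum _ _ _) _.
apply: (@le_trans _ _ (\sum_(j < n.+1) B * ((n.+1%:R * B) ^+ k * V))).
  by apply: ler_sum => j _; rewrite normrM ler_pM.
by rewrite sumr_const card_ord exprS -[leLHS]mulr_natl !mulrA.
Qed.

(** Multiplying the characteristic polynomial by $\prod_i (X + l_i)$ gives $\prod_i (X^2 - l_i^2)$,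
    so by Cayley-Hamilton $A^2$ is annihilated by a cubic with roots $l_i^2$. *)
Lemma square_rec3 (R : fieldType) (A : 'M[R]_3) (l : 'I_3 -> R)
    (v : 'cV[R]_3) (i : nat) (j : 'I_3) :
  char_poly A = \prod_(i < 3) ('X - (l i)%:P) ->
  let x m := (A ^+ (2 * m + i) *m v) j 0 in
  let a := l ord0 ^+ 2 in let b := l (inord 1) ^+ 2 in let c := l (inord 2) ^+ 2 in
  forall m, x m.+3 = (a + b + c) * x m.+2 - (a * b + a * c + b * c) * x m.+1
                     + a * b * c * x m.
Proof.
move=> AE x a b c m.
have e1 : lift ord0 ord0 = inord 1 :> 'I_3 by apply: val_inj; rewrite /= inordK.
have e2 : lift ord0 (lift ord0 ord0) = inord 2 :> 'I_3.
  by apply: val_inj; rewrite /= inordK.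
have hornerE' f g h :
    horner_mx A ('X ^+ 6 - f%:P * 'X ^+ 4 + g%:P * 'X ^+ 2 - h%:P) =
    A ^+ 6 - f%:M * A ^+ 4 + g%:M * A ^+ 2 - h%:M.
  rewrite rmorphB rmorphD rmorphB /= (rmorphM _ f%:P) (rmorphM _ g%:P).
  by rewrite !rmorphXn /= !horner_mx_C horner_mx_X.
have A6 : A ^+ 6 - (a + b + c)%:M * A ^+ 4 + (a * b + a * c + b * c)%:M * A ^+ 2
    - (a * b * c)%:M = 0.
  pose Q := ('X + (l ord0)%:P) * ('X + (l (inord 1))%:P) * ('X + (l (inord 2))%:P).
  have /(congr1 (horner_mx A)) : char_poly A * Q =
      'X ^+ 6 - (a + b + c)%:P * 'X ^+ 4 + (a * b + a * c + b * c)%:P * 'X ^+ 2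
      - (a * b * c)%:P.
    rewrite AE !big_ord_recl big_ord0 e1 e2 /Q /a /b /c.
    by rewrite !(polyCD, polyCM, polyC_exp); ring.
  rewrite rmorphM /= Cayley_Hamilton mul0r => /esym.
  by rewrite hornerE' => ->.
pose w := A ^+ (2 * m + i) *m v.
have xE k : x (k + m)%N = (A ^+ (2 * k) *m w) j 0.
  by rewrite /x /w mulmxA mulmxE -exprD mulnDr addnA.
rewrite (xE 3%N) (xE 2%N) (xE 1%N) (xE 0%N) muln0 expr0 mul1mx /muln /=.
move: A6; move: (A ^+ 6) (A ^+ 4) (A ^+ 2) => B6 B4 B2.
move=> /(congr1 (fun B : 'M_3 => B *m w)).
rewrite -!mulmxE !(mulmxBl, mulmxDl) -!mulmxA !mul_scalar_mx mul0mx.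
move: (B6 *m w) (B4 *m w) (B2 *m w) => y6 y4 y2.
move=> /matrixP /(_ j 0); rewrite !mxE => y_rec.
apply/eqP; rewrite -subr_eq0 -[X in _ == X]y_rec; apply/eqP; ring.
Qed.

Lemma nat_bitsP n : (n < 2 ^ nat_bits n)%N.
Proof. exact: trunc_log_ltn. Qed.

(** * Denominators and bit lengths *)

Lemma int_bitsP (z : int) : (`|z| < 2 ^ int_bits z)%N.
Proof. by apply: leq_trans (nat_bitsP _) _; rewrite leq_pexp2l // leqnSn. Qed.

(** A plain product instead of a least common multiple: its bit length is bounded by adding those of
    the entries. *)
Definition mxden m n (A : 'M[rat]_(m, n)) : int := \prod_i \prod_j denq (A i j).

Definition mxnum m n (A : 'M[rat]_(m, n)) : 'M[int]_(m, n) :=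
  map_mx (fun x => numq ((mxden A)%:~R * x)) A.

Lemma mxden_gt0 m n (A : 'M[rat]_(m, n)) : 0 < mxden A.
Proof. by apply: prodr_gt0 => i _; apply: prodr_gt0 => j _; exact: denq_gt0. Qed.

Lemma mxnumE m n (A : 'M[rat]_(m, n)) :
  map_mx intr (mxnum A) = (mxden A)%:~R *: A.
Proof.
apply/matrixP => i j; rewrite !mxE.
have -> : (mxden A)%:~R * A i j = (\prod_(i' | i' != i) \prod_j' denq (A i' j') *
    \prod_(j' | j' != j) denq (A i j') * numq (A i j))%:~R.
  rewrite /mxden (bigD1 i) //= (bigD1 j) //= !rmorphM /= numqE; ring.
by rewrite numq_int.
Qed.

Lemma leq_rat_bits m n (A : 'M[rat]_(m, n)) i j : (rat_bits (A i j) <= mx_bits A)%N.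
Proof.
rewrite /mx_bits (bigD1 i) //= (bigD1 j) //= -addnA leq_addr //.
Qed.

Lemma mxden_bound m n (A : 'M[rat]_(m, n)) : (`|mxden A| <= 2 ^ mx_bits A)%N.
Proof.
rewrite /mxden /mx_bits; elim/big_ind2: _ => // [x a y b lex ley|i _].
  by rewrite abszM expnD leq_mul.
elim/big_ind2: _ => // [x a y b lex ley|j _]; first by rewrite abszM expnD leq_mul.
by rewrite ltnW // (leq_trans (nat_bitsP _)) // leq_pexp2l // leq_addl.
Qed.

Lemma ler_numq (x : rat) : `|x| <= `|numq x|%:~R.
Proof.
rewrite intr_norm numqE normrM ler_peMr // -intr_norm ler1z.
by rewrite -gtz0_ge1 normr_gt0 denq_neq0.
Qed.

Lemma mxnum_bound m n (A : 'M[rat]_(m, n)) i j :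
  (`|mxnum A i j| <= 2 ^ (2 * mx_bits A))%N.
Proof.
have := congr1 (fun B : 'M_(m, n) => B i j) (mxnumE A); rewrite !mxE => AE.
rewrite -lez_nat abszE -(ler_int rat) intr_norm AE normrM.
rewrite mul2n -addnn expnD PoszM rmorphM /= ler_pM //.
  by rewrite -intr_norm -abszE ler_int lez_nat mxden_bound.
apply: le_trans (ler_numq _) _; rewrite -abszE ler_int lez_nat ltnW //.
apply: leq_trans (int_bitsP _) _.
by rewrite leq_pexp2l // (leq_trans _ (leq_rat_bits A i j)) // leq_addr.
Qed.

Lemma mxnum_pow (M : 'M[rat]_3) (s : 'cV[rat]_3) n :
  map_mx intr (mxnum M ^+ n *m mxnum s) =
  ((mxden M ^+ n * mxden s)%:~R : rat) *: (M ^+ n *m s).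
Proof.
rewrite map_mxM rmorphXn /= !mxnumE rmorphM rmorphXn /= exprZn.
by rewrite -scalemxAl -scalemxAr scalerA.
Qed.

(** Nine entries, each with a sign bit and at least one digit for numerator and denominator. This
    lower bound on the instance size absorbs the constants of later estimates. *)
Lemma leq_mx_bits3 (M : 'M[rat]_3) : (27 <= mx_bits M)%N.
Proof.
have bits3 (x : rat) : (3 <= rat_bits x)%N.
  by rewrite /rat_bits /int_bits /nat_bits; lia.
rewrite /mx_bits; apply: (@leq_trans (\sum_(i < 3) \sum_(j < 3) 3)%N).
  by rewrite !sum_nat_const !card_ord.
by apply: leq_sum => i _; apply: leq_sum => j _.
Qed.

(** Here the zero coefficients count: listing them makes the bit length bound the degree. *)
Lemma msize_bits (p : {mpoly int[3]}) : (msize p <= mpoly_bits p)%N.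
Proof.
apply: (leq_trans (leq_size_triples3 _)).
rewrite /mpoly_bits /coefs monomials3E -map_comp big_map -sum1_size.
by apply: leq_sum => t _.
Qed.

Lemma mpoly_coefs_bound (p : {mpoly int[3]}) :
  (\sum_(t <- triples3 (msize p)) `|p@_(mono3 t)| <= 2 ^ mpoly_bits p)%N.
Proof.
rewrite /mpoly_bits /coefs monomials3E -map_comp big_map.
elim: (triples3 _) => [|t r IH]; first by rewrite big_nil.
rewrite !big_cons expnD /=; have := int_bitsP p@_(mono3 t).
move: IH; set a := (\sum_(_ <- _) _)%N; set b := (2 ^ (\sum_(_ <- _) _))%N.
set c := (2 ^ _)%N => ab; have : (0 < b)%N by rewrite expn_gt0.
move: ab; clearbody a b c; nia.
Qed.

(** * Eventual sign along a parity class *)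

Lemma past_bound (R : archiRealFieldType) I m :
  (27 <= I)%N -> (2 ^ I ^ 7 <= m)%N ->
  past 3 ((2 ^ (469 * I ^ 2))%:R : R) (2 * I) ((2 ^ (26 * I ^ 2))%:R) (m - 2).
Proof.
move=> I27 le_m.
have I2 : (500 <= I ^ 2)%N by rewrite expnS expn1; nia.
have I5 : (I ^ 5 = I ^ 2 * I ^ 2 * I)%N by rewrite -!expnD -expnSr.
have I5_ge : (500 * I ^ 2 * 27 <= I ^ 5)%N by rewrite I5 !leq_mul.
have I_le : (I <= I ^ 2)%N by rewrite expnS expn1; nia.
have I5W : (469 * I ^ 2 * 6 < I ^ 5)%N.
  by move: (I ^ 2)%N (I ^ 5)%N I2 I5_ge; lia.
have I5H : (4 + (I * 2 + 322 * I ^ 2) <= I ^ 5)%N.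
  by move: (I ^ 2)%N (I ^ 5)%N I2 I5_ge I_le; lia.
(* Two of the seven powers of [I] are given up to pay for the index shift by 2; the remaining
   $2^{I^5}$ is ample. *)
have {le_m} le_m : (2 ^ I ^ 5 <= m - 2)%N.
  have : (2 * 2 ^ I ^ 5 <= 2 ^ I ^ 7)%N.
    rewrite -expnS leq_pexp2l // -[7%N]/(5 + 2)%N expnD.
    by move: (I ^ 2)%N (I ^ 5)%N I2 I5W; nia.
  have : (2 <= 2 ^ I ^ 5)%N by rewrite (@leq_pexp2l 2 1) //; lia.
  by move: (2 ^ I ^ 5)%N (2 ^ I ^ 7)%N le_m; lia.
split.
- by apply: leq_trans le_m; rewrite expn_gt0.
- by rewrite -natrX ltr_nat -expnM; apply: leq_trans le_m; rewrite ltn_exp2l.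
rewrite -!(natrX, natrM) ler_nat; apply: leq_trans le_m.
rewrite -[(3`!).-1]/5%N -expnS -expnM -expnD -expnM -[16%N]/((2 ^ 4)%N).
(* With $e = 5$, the square of $H(2H)^5$ has exponent $2(6 \cdot 26 I^2 + 5) \le 322 I^2$, and $2I+1
   \le 2^I$. *)
apply: (@leq_trans (2 ^ 4 * (2 ^ I) ^ 2 * 2 ^ (322 * I ^ 2))); last first.
  by rewrite -expnM -!expnD leq_pexp2l // -addnA.
apply: leq_mul; last by rewrite leq_pexp2l //; move: (I ^ 2)%N I2; lia.
rewrite leq_mul2l leq_exp2r // orbC /=.
have [k ->] : exists k, I = (k + 4)%N by exists (I - 4)%N; lia.
by elim: k => // k IH; rewrite addSn expnS; lia.
Qed.

(** Padding each monomial to degree [d] with the common scale [z * w] makes the factor in front of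
    it independent of the monomial. *)
Lemma homogenize (R : comNzRingType) (z w c y0 y1 y2 : R) d i j k :
  (i + j + k <= d)%N ->
  c * ((z * w) ^+ (d - (i + j + k)) *
       ((z * (w * y0)) ^+ i * (z * (w * y1)) ^+ j * (z * (w * y2)) ^+ k)) =
  (z * w) ^+ d * (c * (y0 ^+ i * y1 ^+ j * y2 ^+ k)).
Proof.
move=> le_d; rewrite !(mulrA z w) !(exprMn _ (z * w)).
rewrite -[in RHS](subnK le_d) !exprD; set q := GRing.mul z w.
by move: (q ^+ _) (q ^+ i) (q ^+ j) (q ^+ k) (y0 ^+ i) (y1 ^+ j) (y2 ^+ k) => *; ring.
Qed.

Section SignStable.
Variables (R : realType) (M : 'M[rat]_3) (s : 'cV[rat]_3) (p : {mpoly int[3]}).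
Variable l : 'I_3 -> R.
Hypothesis lE :
  char_poly (map_mx ratr M : 'M[R]_3) = \prod_(i < 3) ('X - (l i)%:P).

Let I := instance_bits M s p.
Let D := mxden M.
Let E := mxden s.
Let A := mxnum M.
Let v := mxnum s.
Let mu k : R := D%:~R * l k.
(** The first six orbit vectors are at most $(2^2 \cdot 2^{2I})^5 \cdot 2^{2I} = 2^{12I+10}$, and
    $10 \le I$. *)
Let C : R := (2 ^ (13 * I))%:R.

Let I27 : (27 <= I)%N.
Proof. by rewrite /I /instance_bits; have := leq_mx_bits3 M; lia. Qed.

Let bitsM : (mx_bits M <= I)%N. Proof. by rewrite /I /instance_bits; lia. Qed.
Let bitss : (mx_bits s <= I)%N. Proof. by rewrite /I /instance_bits; lia. Qed.
Let bitsp : (mpoly_bits p <= I)%N. Proof. by rewrite /I /instance_bits; lia. Qed.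

Let D0 : 0 < D%:~R :> R. Proof. by rewrite ltr0z mxden_gt0. Qed.
Let E0 : 0 < E%:~R :> R. Proof. by rewrite ltr0z mxden_gt0. Qed.

Let AE : map_mx intr A = D%:~R *: map_mx ratr M :> 'M[R]_3.
Proof.
apply/matrixP => i j; have := congr1 (fun B : 'M_3 => ratr (B i j) : R) (mxnumE M).
by rewrite !mxE ratr_int rmorphM /= ratr_int.
Qed.

Let char_A : char_poly (map_mx intr A : 'M[R]_3) = \prod_(i < 3) ('X - (mu i)%:P).
Proof. by rewrite AE; apply: char_poly_scale => //; rewrite gt_eqF. Qed.

Let muE : \prod_(i < 3) ('X - (mu i)%:P) = map_poly intr (char_poly A) :> {poly R}.
Proof. by rewrite -char_A map_char_poly. Qed.

Let C4 : 4 <= C.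
Proof. by rewrite /C ler_nat (@leq_pexp2l 2 2) //; lia. Qed.

Let absA i j : `|A i j| <= (2 ^ (2 * I))%N :> int.
Proof.
by rewrite -abszE lez_nat (leq_trans (mxnum_bound _ _ _)) // leq_pexp2l //; lia.
Qed.

Let absv i : `|v i 0| <= (2 ^ (2 * I))%N :> int.
Proof.
by rewrite -abszE lez_nat (leq_trans (mxnum_bound _ _ _)) // leq_pexp2l //; lia.
Qed.

Let mu_bound k : `|mu k| <= C.
Proof.
have : root (char_poly (map_mx intr A : 'M[R]_3)) (mu k).
  by rewrite char_A (bigD1 k) //= rootM root_XsubC eqxx.
move=> /(eigenvalue_bound (B := (2 ^ (2 * I))%:R)) le_mu.
apply: le_trans (le_mu _) _.
  by move=> i j; rewrite mxE -intr_norm [leRHS]pmulrn ler_int absA.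
rewrite -natrM /C ler_nat (@leq_trans (2 ^ 2 * 2 ^ (2 * I))) ?leq_mul2r ?orbT //.
by rewrite -expnD leq_pexp2l //; lia.
Qed.

Let x (j : 'I_3) (k : nat) : R := ((A ^+ k *m v) j 0)%:~R.

Let x_bound j k : (k <= 5)%N -> zbounded mu C 1 (x j k).
Proof.
move=> k5; have leqX a b : (a <= b)%N -> (a ^ k <= b ^ k)%N.
  by case: k {k5} => // k; rewrite leq_exp2r.
apply: zbounded_int; rewrite /C [leRHS]pmulrn ler_int.
apply: le_trans (mx_pow_bound k j absA absv) _.
rewrite -PoszM -rmorphXn -rmorphM /= lez_nat.
apply: (@leq_trans ((2 ^ 2 * 2 ^ (2 * I)) ^ 5 * 2 ^ (2 * I))).
  rewrite leq_mul2r (@leq_trans ((2 ^ 2 * 2 ^ (2 * I)) ^ k)) ?orbT //.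
    by rewrite natrXE leqX // leq_mul2r orbT.
  by rewrite leq_pexp2l // muln_gt0 !expn_gt0.
by rewrite -expnD -expnM -expnD leq_pexp2l //; lia.
Qed.

Let den_bound (z : int) : (`|z| <= 2 ^ I)%N -> zbounded mu C 1 z%:~R.
Proof.
move=> zI; apply: zbounded_int; rewrite /C [leRHS]pmulrn ler_int -abszE lez_nat.
by apply: leq_trans zI _; rewrite leq_pexp2l //; lia.
Qed.

Let zD : zbounded mu C 1 D%:~R.
Proof. by apply/den_bound/(leq_trans (mxden_bound _)); rewrite leq_pexp2l. Qed.

Let zE : zbounded mu C 1 E%:~R.
Proof. by apply/den_bound/(leq_trans (mxden_bound _)); rewrite leq_pexp2l. Qed.

Let y (n : nat) (k : 'I_3) : R := (map_mx ratr (M ^+ n *m s) : 'cV[R]_3) k 0.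

Let w (n : nat) : R := D%:~R ^+ n * E%:~R.

Let xE n k : x k n = w n * y n k.
Proof.
have := congr1 (fun B : 'cV_3 => ratr (B k 0) : R) (mxnum_pow M s n).
rewrite [X in X = _](_ : _ = x k n); last by rewrite mxE ratr_int.
move=> ->; rewrite /y [in RHS]mxE [X in ratr X]mxE rmorphM /= ratr_int.
by rewrite rmorphM rmorphXn.
Qed.

Lemma sign_stable_class i : (i <= 1)%N -> exists b : R, forall m,
  (2 ^ I ^ 7 <= m)%N -> Num.sg (ieval (y (2 * m + i)) p) = b.
Proof.
move=> i1.
have zmu k : zbounded mu C 2 (mu k ^+ 2).
  by apply: (zboundedX (k := 1) 2); apply: zbounded_mu.
have [Z [Z0 zZ] exZ] := rec3_expsum C4 (zmu ord0) (zmu (inord 1)) (zmu (inord 2))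
  (sqr_ge0 _) (sqr_ge0 _) (sqr_ge0 _).
pose N m := (2 * m.+2 + i)%N.
have C1 : 1 <= C by apply: le_trans C4; rewrite ler1n.
have ex_x j : expsum mu (C ^+ 36) 2 (C ^+ 2) (fun m => Z * x j (N m)).
  apply: (@expsum_le _ _ _ (C ^+ 30) _ 2 _ (C ^+ 2)) => //.
    by rewrite ler_weXn2l.
  apply: (exZ (fun m => x j (2 * m + i))); try by apply: x_bound; lia.
  have xA k : x j k = ((map_mx intr A : 'M[R]_3) ^+ k *m map_mx intr v) j 0.
    by rewrite -rmorphXn /= -map_mxM mxE.
  by move=> m; rewrite !xA; exact: (square_rec3 (map_mx intr v) i j char_A m).
(* The scale [w] is itself geometric along a parity class, with ratio $D^2$. The exponent 36 is 30
   for [Z], at most 5 for [D ^+ (4 + i)] and 1 for [E]. *)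
have ex_w : expsum mu (C ^+ 36) 2 (C ^+ 2) (fun m => Z * w (N m)).
  have zc : zbounded mu C 36 (Z * (D%:~R ^+ (4 + i) * E%:~R)).
    apply: (zbounded_le C4 _ (zboundedM zZ (zboundedM (zboundedX (4 + i) zD) zE))).
    by lia.
  have zD2 : zbounded mu C 2 (D%:~R ^+ 2) := zboundedX 2 zD.
  have := zbounded_expsum 0 zc zD2 (sqr_ge0 _).
  move=> /(expsum_le (lexx _) (leq0n 2) (lexx _)); apply: eq_expsum => m.
  rewrite /w (_ : N m = (4 + i + 2 * m)%N); last by rewrite /N; lia.
  rewrite expr0 mulr1 (exprD _ (4 + i)) (exprM _ 2).
  by move: (_ ^+ (4 + i)) (_ ^+ m) => c1 c2; ring.
pose d := msize p.
pose T (t : nat * (nat * nat)) m := (p@_(mono3 t))%:~R *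
  ((Z * w (N m)) ^+ (d - (t.1 + t.2.1 + t.2.2)) * ((Z * x ord0 (N m)) ^+ t.1 *
   (Z * x (inord 1) (N m)) ^+ t.2.1 * (Z * x (inord 2) (N m)) ^+ t.2.2)).
have TE m : \sum_(t <- triples3 d) T t m = (Z * w (N m)) ^+ d * ieval (y (N m)) p.
  rewrite ieval_triples3 mulr_sumr [LHS]big_seq [RHS]big_seq; apply: eq_bigr.
  move=> [t1 [t2 t3]]; rewrite mem_triples3 /T /= => lt_t.
  by rewrite !xE homogenize // ltnW.
have exT t : t \in triples3 d -> expsum mu (`|p@_(mono3 t)|%:~R * (C ^+ 36) ^+ d)
    (2 * d) ((C ^+ 2) ^+ d) (T t).
  case: t => [t1 [t2 t3]]; rewrite mem_triples3 => lt_t.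
  have := expsumM (expsum_int mu p@_(mono3 (t1, (t2, t3))))
    (expsumM (expsumX (d - (t1 + t2 + t3)) ex_w) (expsumM (expsumM
    (expsumX t1 (ex_x ord0)) (expsumX t2 (ex_x (inord 1))))
    (expsumX t3 (ex_x (inord 2))))).
  have dE : d = ((d - (t1 + t2 + t3)) + (t1 + t2 + t3))%N by rewrite subnK // ltnW.
  apply: expsum_le; first by rewrite {2}dE !exprD !mulrA.
    by rewrite [leqRHS](congr1 _ dE); lia.
  by rewrite mul1r {2}dE !exprD !mulrA.
(* As $d \le I$, the weights total at most $2^I \cdot 2^{13 \cdot 36 I d} \le 2^{469 I^2}$, and the
   bases are at most $2^{13 \cdot 2 I d} \le 2^{26 I^2}$. *)
have [|||b bP] := @expsum_sign_stable _ _ mu _ muE ((2 ^ (469 * I ^ 2))%:R)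
  (2 * I) ((2 ^ (26 * I ^ 2))%:R) (fun m => \sum_(t <- triples3 d) T t m).
- by rewrite ler1n expn_gt0.
- by rewrite ler1n expn_gt0.
- have dI : (d <= I)%N := leq_trans (msize_bits p) bitsp.
  have := expsum_sum exT; apply: expsum_le.
  + have -> : \sum_(t <- triples3 d) `|p@_(mono3 t)|%:~R * (C ^+ 36) ^+ d =
        (\sum_(t <- triples3 d) `|p@_(mono3 t)|)%:~R * (2 ^ (13 * I * 36 * d))%:R.
      rewrite -mulr_suml rmorph_sum /=; congr (_ * _).
      by rewrite /C -!natrX -!expnM mulnA.
    apply: (@le_trans _ _ ((2 ^ I)%:R * (2 ^ (13 * I * 36 * d))%:R)).
      rewrite ler_wpM2r // [leRHS]pmulrn ler_int.
      under eq_bigr do rewrite -abszE.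
      rewrite -(big_morph Posz PoszD (erefl _)) lez_nat.
      by apply: leq_trans (mpoly_coefs_bound p) _; rewrite leq_pexp2l.
    rewrite -natrM ler_nat -expnD leq_pexp2l //; nia.
  + by rewrite leq_mul2l dI.
  + by rewrite /C -!natrX -!expnM ler_nat leq_pexp2l //; nia.
(* [w] is positive, but [Z] may have either sign; as the sign of [Z ^+ d] squares to 1, multiplying
   by it once more removes it. *)
exists (Num.sg (Z ^+ d) * b) => m le_m.
have m2 : N (m - 2)%N = (2 * m + i)%N.
  have : (2 ^ 1 <= 2 ^ I ^ 7)%N by rewrite leq_pexp2l // expn_gt0; lia.
  by rewrite /N; lia.
have := bP _ (past_bound R I27 le_m).
rewrite TE m2 => <-; rewrite exprMn sgrM sgrM.
have wd0 : 0 < w (2 * m + i) ^+ d by rewrite exprn_gt0 // mulr_gt0 // exprn_gt0.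
rewrite (gtr0_sg wd0) mulr1 mulrA -expr2 sqr_sg.
by rewrite expf_neq0 // mul1r.
Qed.
End SignStable.

(** * Recursive functions *)

Local Open Scope nat_scope.

(** [recursive] is a predicate on functions with rigid shapes; functional extensionality allows any
    pointwise equal presentation. *)
Lemma eq_recursive k (f g : k.-tuple nat -> nat) :
  f =1 g -> recursive f -> recursive g.
Proof. by move=> /boolp.funext ->. Qed.

Definition recursive1 (f : nat -> nat) : Prop :=
  recursive (fun t : 1.-tuple nat => f (nth 0 t 0)).

Definition recursive2 (f : nat -> nat -> nat) : Prop :=
  recursive (fun t : 2.-tuple nat => f (nth 0 t 0) (nth 0 t 1)).

Definition recursive3 (f : nat -> nat -> nat -> nat) : Prop :=
  recursive (fun t : 3.-tuple nat => f (nth 0 t 0) (nth 0 t 1) (nth 0 t 2)).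

Section Composition.
Variable k : nat.
Implicit Types f : k.-tuple nat -> nat.

Lemma recursive_nth i : i < k -> recursive (fun t : k.-tuple nat => nth 0 t i).
Proof.
move=> lt_ik; apply: eq_recursive (recursive_proj (Ordinal lt_ik)) => t.
exact: tnth_nth.
Qed.

Lemma recursive_comp1 g f :
  recursive1 g -> recursive f -> recursive (fun t => g (f t)).
Proof.
move=> rg rf; apply: eq_recursive (recursive_comp rg (fun=> rf)) => t.
by rewrite (nth_mktuple _ _ ord0).
Qed.

Lemma recursive_comp2 g f1 f2 :
  recursive2 g -> recursive f1 -> recursive f2 ->
  recursive (fun t => g (f1 t) (f2 t)).
Proof.
move=> rg r1 r2; pose f (i : 'I_2) := if i == ord0 then f1 else f2.
have rf i : recursive (f i) by rewrite /f; case: ifP.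
apply: eq_recursive (recursive_comp rg rf) => t.
by rewrite (nth_mktuple _ _ ord0) (nth_mktuple _ _ (@Ordinal 2 1 isT)).
Qed.

End Composition.

Lemma recursive1_id : recursive1 id.
Proof. exact: recursive_nth. Qed.

Lemma recursive1_comp g f : recursive1 g -> recursive1 f -> recursive1 (g \o f).
Proof. exact: recursive_comp1. Qed.

Lemma recursive2_comp g f1 f2 : recursive2 g -> recursive1 f1 -> recursive1 f2 ->
  recursive1 (fun n => g (f1 n) (f2 n)).
Proof. exact: recursive_comp2. Qed.

Lemma recursive1_succ : recursive1 S.
Proof.
by apply: eq_recursive recursive_succ => t; rewrite /thead (tnth_nth 0).
Qed.

Lemma recursive_const k (c : nat) : recursive (fun _ : k.-tuple nat => c).
Proof.
elim: c => [|c IH]; first exact: recursive_zero.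
exact: recursive_comp1 recursive1_succ IH.
Qed.

Lemma recursive2_primrec (g : nat -> nat) (h : nat -> nat -> nat -> nat)
    (f : nat -> nat -> nat) :
  recursive1 g -> recursive3 h -> (forall a, f 0 a = g a) ->
  (forall n a, f n.+1 a = h n (f n a) a) -> recursive2 f.
Proof.
by move=> rg rh f0 fS; apply: (recursive_primrec rg rh) => *; rewrite /= ?f0 ?fS.
Qed.

Lemma recursive1_primrec (c : nat) (h : nat -> nat -> nat) (f : nat -> nat) :
  recursive2 h -> f 0 = c -> (forall n, f n.+1 = h n (f n)) -> recursive1 f.
Proof.
move=> rh f0 fS.
have r2 : recursive2 (fun n _ => f n).
  apply: (@recursive2_primrec (fun=> c) (fun n x _ => h n x)) => //.
    exact: recursive_const.
  by apply: recursive_comp2 => //; exact: recursive_nth.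
exact: recursive_comp2 r2 recursive1_id recursive1_id.
Qed.

Lemma recursive1_min (g : nat -> nat -> nat) (f : nat -> nat) :
  recursive2 g -> (forall a, g (f a) a = 0) ->
  (forall a n, n < f a -> g n a <> 0) -> recursive1 f.
Proof.
by move=> rg g0 gn; apply: (recursive_min rg) => [t|t n lt_n] /=; [exact: g0|exact: gn].
Qed.

Lemma recursive2_add : recursive2 addn.
Proof.
apply: (@recursive2_primrec id (fun _ x _ => x.+1)) => //; first exact: recursive1_id.
by apply: recursive_comp1 recursive1_succ _; exact: recursive_nth.
Qed.

Lemma recursive2_mul : recursive2 muln.
Proof.
apply: (@recursive2_primrec (fun=> 0) (fun _ x a => a + x)) => //.
  exact: recursive_const.
by apply: recursive_comp2 recursive2_add _ _; exact: recursive_nth.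
Qed.

Lemma recursive1_pred : recursive1 predn.
Proof.
by apply: (@recursive1_primrec 0 (fun n _ => n)) => //; exact: recursive_nth.
Qed.

Lemma recursive2_sub : recursive2 subn.
Proof.
(* Primitive recursion runs on the first argument, so subtraction is built with its arguments
   exchanged. *)
have rsub : recursive2 (fun n a => a - n).
  apply: (@recursive2_primrec id (fun _ x _ => x.-1)).
  - exact: recursive1_id.
  - by apply: recursive_comp1 recursive1_pred _; exact: recursive_nth.
  - exact: subn0.
  - by move=> n a; rewrite subnS.
by apply: recursive_comp2 rsub _ _; exact: recursive_nth.
Qed.

Lemma recursive1_odd : recursive1 (fun n => odd n).
Proof.
apply: (@recursive1_primrec 0 (fun _ x => 1 - x)) => //.
  by apply: recursive_comp2 recursive2_sub _ _;
    [exact: recursive_const | exact: recursive_nth].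
by move=> n /=; case: odd.
Qed.

Lemma recursive1_half : recursive1 half.
Proof.
apply: (@recursive1_primrec 0 (fun n x => odd n + x)) => //.
  apply: recursive_comp2 recursive2_add _ _; last exact: recursive_nth.
  by apply: recursive_comp1 recursive1_odd _; exact: recursive_nth.
by move=> n; rewrite -uphalf_half.
Qed.

Lemma recursive1_exp2 : recursive1 (expn 2).
Proof.
apply: (@recursive1_primrec 1 (fun _ x => x + x)) => //.
  by apply: recursive_comp2 recursive2_add _ _; exact: recursive_nth.
by move=> n; rewrite expnS mul2n addnn.
Qed.

Lemma recursive2_iter (f : nat -> nat) : recursive1 f ->
  recursive2 (fun n a => iter n f a).
Proof.
move=> rf; apply: (@recursive2_primrec id (fun _ x _ => f x)) => //.
  exact: recursive1_id.
by apply: recursive_comp1 rf _; exact: recursive_nth.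
Qed.

(* Bijective pairing, chosen so that [CodeSeq.code (n :: s)] is the successor
   of [npair n (CodeSeq.code s)]. *)
Definition npair (x y : nat) : nat := (2 ^ x * y.*2.+1).-1.

Definition unpair1 (z : nat) : nat := logn 2 z.+1.
Definition unpair2 (z : nat) : nat := (iter (unpair1 z) half z.+1)./2.

Lemma npairS x y : (npair x y).+1 = 2 ^ x * y.*2.+1.
Proof. by rewrite prednK // muln_gt0 expn_gt0. Qed.

Lemma iter_half_exp2 x n : iter x half (2 ^ x * n) = n.
Proof.
elim: x n => [|x IH] n; first by rewrite mul1n.
by rewrite iterS expnSr -mulnA IH mul2n doubleK.
Qed.

Lemma unpair1K x y : unpair1 (npair x y) = x.
Proof.
rewrite /unpair1 npairS lognM ?expn_gt0 // pfactorK // lognE /=.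
by rewrite dvdn2 /= odd_double addn0.
Qed.

Lemma unpair2K x y : unpair2 (npair x y) = y.
Proof. by rewrite /unpair2 unpair1K npairS iter_half_exp2 /= uphalf_double. Qed.

Lemma recursive2_pair : recursive2 npair.
Proof.
apply: recursive_comp1 recursive1_pred _; apply: recursive_comp2 recursive2_mul _ _.
  by apply: recursive_comp1 recursive1_exp2 _; exact: recursive_nth.
apply: recursive_comp1 recursive1_succ _.
apply: (@eq_recursive _ (fun t : 2.-tuple nat => nth 0 t 1 + nth 0 t 1)).
  by move=> t; rewrite addnn.
by apply: recursive_comp2 recursive2_add _ _; exact: recursive_nth.
Qed.

Lemma recursive2_half_iter : recursive2 (fun x z => iter x half z.+1).
Proof.
apply: (recursive_comp2 (recursive2_iter recursive1_half)); first exact: recursive_nth.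
by apply: recursive_comp1 recursive1_succ _; exact: recursive_nth.
Qed.

(** The 2-adic valuation of [z.+1] is the least number of halvings that leads to an odd number,
    which is found by minimization. *)
Lemma recursive1_unpair1 : recursive1 unpair1.
Proof.
apply: (@recursive1_min (fun x z => 1 - odd (iter x half z.+1))).
- apply: recursive_comp2 recursive2_sub _ _; first exact: recursive_const.
  exact: recursive_comp1 recursive1_odd recursive2_half_iter.
- move=> z; have [m cm zE] := pfactor_coprime (isT : prime 2) (ltn0Sn z).
  rewrite [in X in iter _ _ X]zE mulnC iter_half_exp2.
  by move: cm; rewrite coprime2n => ->.
- move=> z x lt_x; have [m _ zE] := pfactor_coprime (isT : prime 2) (ltn0Sn z).
  have -> : z.+1 = 2 ^ x * (2 * (m * 2 ^ (unpair1 z - x.+1))).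
    by rewrite [LHS]zE mulnA -expnSr mulnCA -expnD subnKC.
  by rewrite iter_half_exp2 oddM.
Qed.

Lemma recursive1_unpair2 : recursive1 unpair2.
Proof.
apply: recursive_comp1 recursive1_half _.
by apply: recursive_comp2 recursive2_half_iter _ _;
  [exact: recursive1_unpair1 | exact: recursive1_id].
Qed.

(** * Effective functions on encoded data *)

Class encoding (A : Type) := encode : A -> nat.

#[export] Instance encoding_nat : encoding nat := id.
#[export] Instance encoding_bool : encoding bool := nat_of_bool.
#[export] Instance encoding_prod A B `{encoding A} `{encoding B} : encoding (A * B) :=
  fun x => npair (encode x.1) (encode x.2).
#[export] Instance encoding_seq A `{encoding A} : encoding (seq A) :=
  foldr (fun a n => (npair (encode a) n).+1) 0.

Definition effective A B `{encoding A} `{encoding B} (f : A -> B) : Prop :=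
  exists2 g, recursive1 g & forall a, g (encode a) = encode (f a).

Section Effective.
Context {G : Type} `{encoding G}.

Lemma eq_effective A `{encoding A} (f g : G -> A) :
  f =1 g -> effective f -> effective g.
Proof. by move=> fg [h rh hE]; exists h => // a; rewrite hE fg. Qed.

Lemma effective_id : effective (fun x : G => x).
Proof. by exists id => //; exact: recursive1_id. Qed.

Lemma effective_cst A `{encoding A} (a : A) : effective (fun _ : G => a).
Proof. by exists (fun=> encode a) => //; exact: recursive_const. Qed.

Lemma effective_comp A B `{encoding A} `{encoding B} (g : A -> B) (f : G -> A) :
  effective g -> effective f -> effective (fun x => g (f x)).
Proof.
move=> [g' rg gE] [f' rf fE]; exists (g' \o f'); first exact: recursive1_comp.
by move=> a; rewrite /= fE gE.
Qed.

Lemma effective_fst A B `{encoding A} `{encoding B} (f : G -> A * B) :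
  effective f -> effective (fun x => (f x).1).
Proof.
apply: effective_comp; exists unpair1; first exact: recursive1_unpair1.
by move=> [a b]; exact: unpair1K.
Qed.

Lemma effective_snd A B `{encoding A} `{encoding B} (f : G -> A * B) :
  effective f -> effective (fun x => (f x).2).
Proof.
apply: effective_comp; exists unpair2; first exact: recursive1_unpair2.
by move=> [a b]; exact: unpair2K.
Qed.

Lemma effective_pair A B `{encoding A} `{encoding B} (f : G -> A) (g : G -> B) :
  effective f -> effective g -> effective (fun x => (f x, g x)).
Proof.
move=> [f' rf fE] [g' rg gE]; exists (fun n => npair (f' n) (g' n)).
  exact: recursive2_comp recursive2_pair rf rg.
by move=> a; rewrite fE gE.
Qed.

Lemma effective_nat1 (h : nat -> nat) (f : G -> nat) :
  recursive1 h -> effective f -> effective (fun x => h (f x)).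
Proof. by move=> rh; apply: effective_comp; exists h. Qed.

Lemma effective_nat2 (h : nat -> nat -> nat) (f g : G -> nat) :
  recursive2 h -> effective f -> effective g -> effective (fun x => h (f x) (g x)).
Proof.
move=> rh [f' rf fE] [g' rg gE]; exists (fun n => h (f' n) (g' n)).
  exact: recursive2_comp rh rf rg.
by move=> a; rewrite fE gE.
Qed.

Lemma effective_encode A `{encoding A} (f : G -> A) :
  effective f -> effective (fun x => encode (f x)).
Proof. by []. Qed.

Lemma effective_odd (f : G -> nat) : effective f -> effective (fun x => odd (f x)).
Proof. exact: (effective_nat1 recursive1_odd). Qed.

Lemma effective_leq (f g : G -> nat) :
  effective f -> effective g -> effective (fun x => f x <= g x).
Proof.
move=> ef eg.
have [h rh hE] : effective (fun x => 1 - (f x - g x)).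
  apply: (effective_nat2 recursive2_sub); first exact: effective_cst.
  exact: (effective_nat2 recursive2_sub).
exists h => // a; rewrite hE /encode /encoding_nat /encoding_bool.
by rewrite [f a <= g a]/leq; case: (f a - g a).
Qed.

(** The choice becomes a sum in which the code of the condition erases one summand. *)
Lemma effective_if A `{encoding A} (b : G -> bool) (f g : G -> A) :
  effective b -> effective f -> effective g ->
  effective (fun x => if b x then f x else g x).
Proof.
move=> eb ef eg.
have [h rh hE] : effective (fun x =>
    encode (b x) * encode (f x) + (1 - encode (b x)) * encode (g x)).
  apply: (effective_nat2 recursive2_add).
    by apply: (effective_nat2 recursive2_mul).
  apply: (effective_nat2 recursive2_mul) => //.
  by apply: (effective_nat2 recursive2_sub) => //; exact: effective_cst.
exists h => // a; rewrite hE /encode /encoding_nat /encoding_bool.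
by case: (b a); rewrite /= ?mul1n ?addn0 ?add0n.
Qed.

(** The step depends on the context [x], so the iterated state is the pair of [x] and the current
    value. *)
Lemma effective_iter S `{encoding S} (n : G -> nat) (f : G -> S -> S) (s : G -> S) :
  effective n -> effective (fun p : G * S => f p.1 p.2) -> effective s ->
  effective (fun x => iter (n x) (f x) (s x)).
Proof.
move=> [n' rn nE] [f' rf fE] [s' rs sE].
pose step z := npair (unpair1 z) (f' z).
have rstep : recursive1 step.
  exact: recursive2_comp recursive2_pair recursive1_unpair1 rf.
exists (fun z => unpair2 (iter (n' z) step (npair z (s' z)))).
  apply: recursive1_comp recursive1_unpair2 _.
  apply: recursive2_comp (recursive2_iter rstep) rn _.
  exact: recursive2_comp recursive2_pair recursive1_id rs.
move=> a; rewrite nE sE.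
have iterE k : iter k step (npair (encode a) (encode (s a))) =
    encode (a, iter k (f a) (s a)).
  by elim: k => // k IH; rewrite iterS IH /step fE [unpair1 _]unpair1K.
by rewrite iterE [LHS]unpair2K.
Qed.

End Effective.

(** * Effective list operations *)

Section EffectiveSeq.
Context {G : Type} `{encoding G} {A : Type} `{encoding A}.
Implicit Types (l : G -> seq A).

Lemma effective_cons (f : G -> A) l :
  effective f -> effective l -> effective (fun x => f x :: l x).
Proof.
move=> ef el; apply: (effective_nat1 recursive1_succ).
exact: (effective_nat2 recursive2_pair).
Qed.

Lemma effective_nilp l : effective l -> effective (fun x => nilp (l x)).
Proof.
move=> el; have [h rh hE] : effective (fun x => 1 - encode (l x)).
  by apply: (effective_nat2 recursive2_sub) => //; exact: effective_cst.
by exists h => // x; rewrite hE; case: (l x).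
Qed.

Lemma effective_behead l : effective l -> effective (fun x => behead (l x)).
Proof.
move=> el; have [h rh hE] : effective (fun x => unpair2 (encode (l x)).-1).
  apply: (effective_nat1 recursive1_unpair2).
  exact: (effective_nat1 recursive1_pred).
exists h => // x; rewrite hE; case: (l x) => [|y s].
  exact: (unpair2K 0 0).
exact: unpair2K.
Qed.

Lemma effective_head (x0 : A) l : effective l -> effective (fun x => head x0 (l x)).
Proof.
move=> el; have [h rh hE] : effective (fun x => if nilp (l x) then encode x0
    else unpair1 (encode (l x)).-1).
  apply: effective_if; [exact: effective_nilp | exact: effective_cst |].
  apply: (effective_nat1 recursive1_unpair1).
  exact: (effective_nat1 recursive1_pred).
exists h => // x; rewrite hE; case: (l x) => [|y s] //.
exact: unpair1K.
Qed.

Lemma size_encode (s : seq A) : size s <= encode s.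
Proof.
elim: s => // a s IH; rewrite [encode _]npairS /=.
apply: leq_trans (leq_pmull _ _); rewrite ?expn_gt0 // ltnS.
by rewrite -addnn (leq_trans IH) // leq_addr.
Qed.

End EffectiveSeq.

Ltac eff_var :=
  repeat first [eapply effective_id | eapply effective_fst | eapply effective_snd].

(** The state is the rest of the list with the accumulator. The code of the list bounds its length
    and serves as the number of steps; surplus steps leave the state of an empty list unchanged. *)
Lemma effective_foldl {G : Type} `{encoding G} {A : Type} `{EA : encoding A}
    (x0 : A) S `{encoding S} (f : G -> S -> A -> S)
    (s : G -> S) (l : G -> seq A) :
  effective (fun p : G * (S * A) => f p.1 p.2.1 p.2.2) ->
  effective s -> effective l -> effective (fun x => foldl (f x) (s x) (l x)).
Proof.
move=> ef es el.
pose step x (z : seq A * S) := if nilp z.1 then z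
  else (behead z.1, f x z.2 (head x0 z.1)).
apply: (@eq_effective _ _ _ _
  (fun x => (iter (encode (l x)) (step x) (l x, s x)).2)).
  move=> x; have := @size_encode A EA (l x).
  move: (encode (l x)) => n.
  move: (l x) (s x).
  have iter_nil k t : iter k (step x) ([::], t) = ([::], t).
    by elim: k => //= k ->.
  elim: n => [|n IH] [|a r] t le_n //; first by rewrite iter_nil.
  by rewrite iterSr [step x _]/=; exact: IH.
have e1 : effective (fun p : G * (seq A * S) => p.2.1).
  by apply/effective_fst/effective_snd/effective_id.
apply: effective_snd; apply: effective_iter => //; last exact: effective_pair.
apply: effective_if.
- exact: effective_nilp.
- by apply/effective_snd/effective_id.
apply: effective_pair; first exact: effective_behead.
pose ctx (p : G * (seq A * S)) := (p.1, (p.2.2, head x0 p.2.1)).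
have ectx : effective ctx.
  apply: effective_pair; first by apply/effective_fst/effective_id.
  apply: effective_pair; first by apply/effective_snd/effective_snd/effective_id.
  exact: effective_head.
exact: (effective_comp ef ectx).
Qed.

Section EffectiveSeq2.
Context {G : Type} `{encoding G} {A : Type} `{encoding A} (x0 : A).
Implicit Types (l : G -> seq A).

Lemma effective_rev l : effective l -> effective (fun x => rev (l x)).
Proof.
move=> el.
apply: (@eq_effective _ _ _ _ (fun x => foldl (fun s a => a :: s) [::] (l x))).
  by move=> x; rewrite /rev; elim: (l x) [::] => //= a s IH t; rewrite IH.
apply: (effective_foldl x0) el; last exact: effective_cst.
by apply: effective_cons; eff_var.
Qed.

Lemma effective_foldr S `{encoding S} (f : G -> A -> S -> S) (s : G -> S) l :
  effective (fun p : G * (A * S) => f p.1 p.2.1 p.2.2) ->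
  effective s -> effective l -> effective (fun x => foldr (f x) (s x) (l x)).
Proof.
move=> ef es el.
apply: (@eq_effective _ _ _ _
  (fun x => foldl (fun t a => f x a t) (s x) (rev (l x)))).
  by move=> x; rewrite foldl_rev.
apply: (effective_foldl x0) => //; last exact: effective_rev.
pose swap (p : G * (S * A)) := (p.1, (p.2.2, p.2.1)).
have eswap : effective swap.
  by do 2?apply: effective_pair; eff_var.
exact: (effective_comp ef eswap).
Qed.

End EffectiveSeq2.

Section EffectiveSeq3.
Context {G : Type} `{encoding G} {A : Type} `{encoding A}.
Implicit Types (l : G -> seq A).

Lemma effective_map (x0 : A) B `{encoding B} (f : G -> A -> B) l :
  effective (fun p : G * A => f p.1 p.2) -> effective l ->
  effective (fun x => [seq f x a | a <- l x]).
Proof.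
move=> ef el.
apply: (@eq_effective _ _ _ _ (fun x => foldr (fun a s => f x a :: s) [::] (l x))).
  by move=> x; elim: (l x) => //= a s ->.
apply: (effective_foldr x0) => //; last exact: effective_cst.
apply: effective_cons; last by eff_var.
pose proj (p : G * (A * seq B)) := (p.1, p.2.1).
have eproj : effective proj by apply: effective_pair; eff_var.
exact: (effective_comp ef eproj).
Qed.

Lemma effective_cat (x0 : A) l l' :
  effective l -> effective l' -> effective (fun x => l x ++ l' x).
Proof.
move=> el el'.
apply: (@eq_effective _ _ _ _ (fun x => foldr cons (l' x) (l x))).
  by move=> x; elim: (l x) => //= a s ->.
by apply: (effective_foldr x0) => //; apply: effective_cons; eff_var.
Qed.

Lemma effective_size (x0 : A) l : effective l -> effective (fun x => size (l x)).
Proof.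
move=> el; apply: (@eq_effective _ _ _ _ (fun x => foldr (fun _ => S) 0 (l x))).
  by move=> x; elim: (l x) => //= a s ->.
apply: (effective_foldr x0) => //; last exact: effective_cst.
by apply: (effective_nat1 recursive1_succ); eff_var.
Qed.

Lemma effective_nth (x0 : A) l i :
  effective l -> effective i -> effective (fun x => nth x0 (l x) (i x)).
Proof.
move=> el ei.
apply: (@eq_effective _ _ _ _ (fun x => head x0 (iter (i x) behead (l x)))).
  move=> x; elim: (i x) (l x) => [|n IH] [|a s] //; rewrite iterSr IH //.
  exact: nth_nil.
by apply/effective_head/effective_iter => //; apply: effective_behead; eff_var.
Qed.

End EffectiveSeq3.

Section EffectiveSeq4.
Context {G : Type} `{encoding G} {A : Type} `{encoding A}.

Lemma effective_flatten (x0 : A) (l : G -> seq (seq A)) :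
  effective l -> effective (fun x => flatten (l x)).
Proof.
move=> el; apply: (effective_foldr [::]) => //; last exact: effective_cst.
by apply: (effective_cat x0); eff_var.
Qed.

Lemma effective_iota (m n : G -> nat) :
  effective m -> effective n -> effective (fun x => iota (m x) (n x)).
Proof.
move=> em en.
apply: (@eq_effective _ _ _ _ (fun x => rev
  (iter (n x) (fun s => (m x + size s) :: s) [::]))).
  move=> x; rewrite -[RHS]revK; congr rev.
  elim: (n x) => // k IH; rewrite iterS IH size_rev size_iota.
  by rewrite -[in RHS]addn1 iotaD rev_cat.
apply: (effective_rev 0); apply: effective_iter => //; last exact: effective_cst.
apply: effective_cons; last by eff_var.
apply: (effective_nat2 recursive2_add).
  by apply: effective_comp em _; eff_var.
by apply: (effective_size 0); eff_var.
Qed.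

End EffectiveSeq4.

(** * The decision procedure *)

(* [((a, b), c)] stands for the rational number [(a - b) / c]. *)
Notation frac := (nat * nat * nat)%type.

Definition frac_add (x y : frac) : frac :=
  ((x.1.1 * y.2 + y.1.1 * x.2, x.1.2 * y.2 + y.1.2 * x.2), x.2 * y.2).

Definition frac_mul (x y : frac) : frac :=
  ((x.1.1 * y.1.1 + x.1.2 * y.1.2, x.1.1 * y.1.2 + x.1.2 * y.1.1), x.2 * y.2).

Definition frac_exp (x : frac) (n : nat) : frac := iter n (frac_mul x) ((1, 0), 1).

(** An odd code $2n+1$ stands for $-(n+1)$, whence the [c.+1./2]. *)
Definition decode_int (c : nat) : nat * nat :=
  if odd c then (0, c.+1./2) else (c./2, 0).

(** Numerator and denominator occupy adjacent places; the denominator is positive, so halving its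
    code recovers it. *)
Definition entry (L : seq nat) (k : nat) : frac :=
  (decode_int (nth 0 L (2 * k)), (nth 0 L (2 * k).+1)./2).

Notation frac3 := (frac * (frac * frac))%type.

Definition orbit_coord (L : seq nat) (k : nat) (x : frac3) : frac :=
  frac_add (frac_mul (entry L k) x.1)
    (frac_add (frac_mul (entry L k.+1) x.2.1) (frac_mul (entry L k.+2) x.2.2)).

(** Entries 0 to 8 are the matrix, row by row, and 9 to 11 the vector. *)
Definition orbit_step (L : seq nat) (x : frac3) : frac3 :=
  (orbit_coord L 0 x, (orbit_coord L 3 x, orbit_coord L 6 x)).

Definition orbit (L : seq nat) (n : nat) : frac3 :=
  iter n (orbit_step L) (entry L 9, (entry L 10, entry L 11)).

(** Inverts [d |-> size (triples3 d)]: by strict growth exactly the [e] below [d] are counted, and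
    [d <= n] makes the range long enough. *)
Definition degree_of_size (n : nat) : nat :=
  foldr (fun e k => (size (triples3 e) < n) + k) 0 (iota 0 n).

Definition eval_step (x : frac3) (z : frac * seq nat) (t : nat * (nat * nat)) :
    frac * seq nat :=
  (frac_add z.1 (frac_mul (decode_int (head 0 z.2), 1)
     (frac_mul (frac_mul (frac_exp x.1 t.1) (frac_exp x.2.1 t.2.1))
               (frac_exp x.2.2 t.2.2))), behead z.2).

Definition eval_coefs (K : seq nat) (x : frac3) : frac :=
  (foldl (eval_step x) (((0, 0), 1), K) (triples3 (degree_of_size (size K)))).1.

Definition frac_test (r : sign_cond) (x : frac) : bool :=
  match r with Gt0 => x.1.2 < x.1.1 | Ge0 => x.1.2 <= x.1.1 end.

Lemma code_encode (L : seq nat) : CodeSeq.code L = encode L.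
Proof. by elim: L => // a L IH; rewrite [LHS]/= IH [RHS]npairS. Qed.

(** Twice the code of the instance bounds its bit length, so half of this exponent is past the point
    $2^{I^7}$ while bit lengths never have to be computed. *)
Definition test_time (n i : nat) : nat := 2 * 2 ^ (2 * n) ^ 7 + i.

(** The 24 numbers skipped are the numerators and denominators of the 12 entries of matrix and
    vector. *)
Definition parity_test (r : sign_cond) (L : seq nat) (i : nat) : bool :=
  frac_test r (eval_coefs (iter 24 behead L) (orbit L (test_time (CodeSeq.code L) i))).

(** * Effectiveness of the decision procedure *)

Section EffectiveAlgorithm.
Context {G : Type} `{encoding G}.

Lemma effective_add (f g : G -> nat) :
  effective f -> effective g -> effective (fun x => f x + g x).
Proof. exact: (effective_nat2 recursive2_add). Qed.

Lemma effective_mul (f g : G -> nat) :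
  effective f -> effective g -> effective (fun x => f x * g x).
Proof. exact: (effective_nat2 recursive2_mul). Qed.

Lemma effective_sub (f g : G -> nat) :
  effective f -> effective g -> effective (fun x => f x - g x).
Proof. exact: (effective_nat2 recursive2_sub). Qed.

Lemma effective_succ (f : G -> nat) : effective f -> effective (fun x => (f x).+1).
Proof. exact: (effective_nat1 recursive1_succ). Qed.

Lemma effective_half (f : G -> nat) : effective f -> effective (fun x => (f x)./2).
Proof. exact: (effective_nat1 recursive1_half). Qed.

Lemma effective_exp2 (f : G -> nat) : effective f -> effective (fun x => 2 ^ (f x)).
Proof. exact: (effective_nat1 recursive1_exp2). Qed.

Ltac eff_arith := repeat first [eassumption | eapply effective_id
  | eapply effective_cst | eapply effective_fst | eapply effective_snd
  | eapply effective_pair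
  | eapply effective_add | eapply effective_mul | eapply effective_sub
  | eapply effective_succ | eapply effective_half].

Lemma effective_frac_add (f g : G -> frac) :
  effective f -> effective g -> effective (fun x => frac_add (f x) (g x)).
Proof. by move=> ef eg; rewrite /frac_add; eff_arith. Qed.

Lemma effective_frac_mul (f g : G -> frac) :
  effective f -> effective g -> effective (fun x => frac_mul (f x) (g x)).
Proof. by move=> ef eg; rewrite /frac_mul; eff_arith. Qed.

Lemma effective_decode_int (f : G -> nat) :
  effective f -> effective (fun x => decode_int (f x)).
Proof.
by move=> ef; apply: effective_if; [exact: effective_odd | eff_arith | eff_arith].
Qed.

Lemma effective_entry (L : G -> seq nat) (k : nat) :
  effective L -> effective (fun x => entry (L x) k).
Proof.
move=> eL; apply: effective_pair.
  by apply/effective_decode_int/effective_nth => //; exact: effective_cst.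
by apply/effective_half/effective_nth => //; exact: effective_cst.
Qed.

End EffectiveAlgorithm.

Ltac eff_arith := repeat first [eassumption | eapply effective_id
  | eapply effective_cst | eapply effective_fst | eapply effective_snd
  | eapply effective_frac_add | eapply effective_frac_mul
  | eapply effective_decode_int | eapply effective_entry | eapply effective_pair
  | eapply effective_add | eapply effective_mul | eapply effective_sub
  | eapply effective_succ | eapply effective_half].

Section EffectiveAlgorithm2.
Context {G : Type} `{encoding G}.

Lemma effective_frac_exp (f : G -> frac) (n : G -> nat) :
  effective f -> effective n -> effective (fun x => frac_exp (f x) (n x)).
Proof.
move=> ef en; apply: effective_iter => //; last exact: effective_cst.
apply: effective_frac_mul; last by eff_arith.
by apply: effective_comp ef _; eff_arith.
Qed.

Lemma effective_orbit_coord (L : G -> seq nat) (k : nat) (x : G -> frac3) :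
  effective L -> effective x -> effective (fun g => orbit_coord (L g) k (x g)).
Proof.
move=> eL ex; apply: effective_frac_add; [|apply: effective_frac_add];
  apply: effective_frac_mul; try exact: effective_entry.
- exact: effective_fst.
- by apply: effective_fst; exact: effective_snd.
- by apply: effective_snd; exact: effective_snd.
Qed.

Lemma effective_triples3 (d : G -> nat) :
  effective d -> effective (fun x => triples3 (d x)).
Proof.
move=> ed; apply: (effective_flatten (0, (0, 0))).
apply: (effective_map 0); last first.
  by apply: effective_iota => //; exact: effective_cst.
apply: (effective_map (0, 0)); first by eff_arith.
apply: (effective_flatten (0, 0)); apply: (effective_map 0).
  apply: (effective_map 0); first by eff_arith.
  apply: effective_iota; first exact: effective_cst.
  do 2?apply: effective_sub; [|by eff_arith|by eff_arith].
  by apply: effective_comp ed _; eff_arith.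
apply: effective_iota; first exact: effective_cst.
apply: effective_sub; last by eff_arith.
by apply: effective_comp ed _; eff_arith.
Qed.

End EffectiveAlgorithm2.

Section EffectiveAlgorithm3.
Context {G : Type} `{encoding G}.

Lemma effective_orbit (L : G -> seq nat) (n : G -> nat) :
  effective L -> effective n -> effective (fun x => orbit (L x) (n x)).
Proof.
move=> eL en; apply: effective_iter => //; last by eff_arith.
have eL1 : effective (fun p : G * frac3 => L p.1).
  by apply: effective_comp eL _; eff_arith.
by apply: effective_pair; [|apply: effective_pair];
  apply: effective_orbit_coord => //; eff_arith.
Qed.

Lemma effective_degree_of_size (n : G -> nat) :
  effective n -> effective (fun x => degree_of_size (n x)).
Proof.
move=> en; apply: (effective_foldr 0); last first.
- by apply: effective_iota => //; exact: effective_cst.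
- exact: effective_cst.
apply: effective_add; last by eff_arith.
apply: effective_leq; last by apply: effective_comp en _; eff_arith.
apply/effective_succ/(effective_size (0, (0, 0)))/effective_triples3.
by eff_arith.
Qed.

Lemma effective_eval_coefs (K : G -> seq nat) (x : G -> frac3) :
  effective K -> effective x -> effective (fun g => eval_coefs (K g) (x g)).
Proof.
move=> eK ex; apply: effective_fst; apply: (effective_foldl (0, (0, 0))).
- have ex1 : effective (fun p : G * ((frac * seq nat) * (nat * (nat * nat))) => x p.1).
    by apply: effective_comp ex _; eff_arith.
  have eh : effective (fun p : G * ((frac * seq nat) * (nat * (nat * nat))) =>
      head 0 p.2.1.2) by apply: effective_head; eff_arith.
  apply: effective_pair; last by apply: effective_behead; eff_arith.
  apply: effective_frac_add; first by eff_arith.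
  apply: effective_frac_mul; first by eff_arith.
  by apply: effective_frac_mul; [apply: effective_frac_mul|];
    apply: effective_frac_exp; eff_arith.
- by eff_arith.
apply/effective_triples3; apply: effective_degree_of_size.
exact: (effective_size 0).
Qed.

Lemma effective_test_time (n i : G -> nat) :
  effective n -> effective i -> effective (fun x => test_time (n x) (i x)).
Proof.
move=> en ei; apply: effective_add => //; apply: effective_mul.
  exact: effective_cst.
(* The exponent 7 is a literal, so the inner power unfolds to a product. *)
apply: effective_exp2; rewrite /expn /=.
by do ?apply: effective_mul => //; exact: effective_cst.
Qed.

Lemma effective_frac_test r : effective (frac_test r).
Proof.
by case: r; apply: effective_leq; [apply: effective_succ|..]; eff_var.
Qed.

Lemma effective_parity_test r (L : G -> seq nat) (i : nat) :
  effective L -> effective (fun x => parity_test r (L x) i).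
Proof.
move=> eL; have ev : effective (fun x => eval_coefs (iter 24 behead (L x))
    (orbit (L x) (test_time (CodeSeq.code (L x)) i))).
  apply: effective_eval_coefs.
    apply: effective_iter => //; first exact: effective_cst.
    by apply: effective_behead; eff_arith.
  apply: effective_orbit => //; apply: effective_test_time; last first.
    exact: effective_cst.
  by apply: eq_effective (effective_encode eL) => x; rewrite code_encode.
exact: (effective_comp (effective_frac_test r) ev).
Qed.

End EffectiveAlgorithm3.

Definition parities (r : sign_cond) (L : seq nat) : {set 'I_2} :=
  [set i : 'I_2 | parity_test r L i].

Lemma parities_codeE r L :
  parities_code (parities r L) = parity_test r L 0 + 2 * parity_test r L 1.
Proof.
rewrite /parities_code big_mkcond !big_ord_recl big_ord0 !inE /=.
by case: (parity_test r L 0); case: (parity_test r L (bump 0 0)).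
Qed.

Lemma parities_computable r : exists2 f : 1.-tuple nat -> nat, recursive f &
  forall L, f [tuple CodeSeq.code L] = parities_code (parities r L).
Proof.
have [g rg gE] : effective (fun L : seq nat =>
    nat_of_bool (parity_test r L 0) + 2 * nat_of_bool (parity_test r L 1)).
  have eL := @effective_id (seq nat) _.
  apply: effective_add; first exact: effective_parity_test.
  by apply: effective_mul; [exact: effective_cst | exact: effective_parity_test].
exists (fun t => g (nth 0 t 0)) => // L.
by rewrite /= code_encode gE parities_codeE.
Qed.

(** * Correctness of the decision procedure *)

Local Open Scope ring_scope.

Definition frac_rep (x : frac) (q : rat) : Prop :=
  (0 < x.2)%N /\ x.1.1%:R - x.1.2%:R = q * x.2%:R.

Lemma frac_rep_add x y p q :
  frac_rep x p -> frac_rep y q -> frac_rep (frac_add x y) (p + q).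
Proof.
case: x y => [[a b] c] [[a' b'] c'] [/= c0 E] [/= c0' E']; split => /=.
  by rewrite muln_gt0 c0.
rewrite !natrD !natrM mulrDl mulrA -E [c%:R * _]mulrC [q * _]mulrA -E'; ring.
Qed.

Lemma frac_rep_mul x y p q :
  frac_rep x p -> frac_rep y q -> frac_rep (frac_mul x y) (p * q).
Proof.
case: x y => [[a b] c] [[a' b'] c'] [/= c0 E] [/= c0' E']; split => /=.
  by rewrite muln_gt0 c0.
by rewrite !natrD !natrM mulrACA -E -E'; ring.
Qed.

Lemma frac_rep_exp x q n : frac_rep x q -> frac_rep (frac_exp x n) (q ^+ n).
Proof.
move=> xq; elim: n => [|n IH]; first by split; rewrite //= expr0 subr0 mul1r.
by rewrite exprS; exact: frac_rep_mul.
Qed.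

Lemma decode_intP (z : int) :
  let d := decode_int (int_code z) in d.1%:R - d.2%:R = z%:~R :> rat.
Proof.
case: z => n; rewrite /decode_int /= odd_double /=.
  by rewrite doubleK subr0.
by rewrite doubleK sub0r NegzE mulrNz.
Qed.

Lemma frac_rep_int (z : int) : frac_rep (decode_int (int_code z), 1%N) z%:~R.
Proof. by split; rewrite //= decode_intP mulr1. Qed.

Lemma frac_rep_rat (q : rat) :
  frac_rep (decode_int (int_code (numq q)), (int_code (denq q))./2) q.
Proof.
have -> : ((int_code (denq q))./2 = `|denq q|)%N.
  by have := denq_gt0 q; case: (denq q) => // n _; rewrite /= doubleK.
split => /=; first by rewrite absz_gt0 denq_neq0.
by rewrite decode_intP numqE -absz_denq pmulrn.
Qed.

Lemma frac_rep_gt0 x q : frac_rep x q -> (x.1.2 < x.1.1)%N = (0 < q).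
Proof.
move=> [c0 E]; have c0' : 0 < x.2%:R :> rat by rewrite ltr0n.
by rewrite -(pmulr_lgt0 q c0') -E subr_gt0 ltr_nat.
Qed.

Lemma frac_rep_ge0 x q : frac_rep x q -> (x.1.2 <= x.1.1)%N = (0 <= q).
Proof.
move=> [c0 E]; have c0' : 0 < x.2%:R :> rat by rewrite ltr0n.
by rewrite -(pmulr_lge0 q c0') -E subr_ge0 ler_nat.
Qed.

Definition frac3_rep (x : frac3) (v : 'I_3 -> rat) : Prop :=
  [/\ frac_rep x.1 (v ord0), frac_rep x.2.1 (v (inord 1))
    & frac_rep x.2.2 (v (inord 2))].

Lemma degree_of_sizeE d : degree_of_size (size (triples3 d)) = d.
Proof.
rewrite /degree_of_size; set n := size _.
have le_dn : (d <= n)%N := leq_size_triples3 d.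
transitivity (count (fun e => e < d)%N (iota 0 n)).
  elim: (iota 0 n) => //= e s ->; congr (nat_of_bool _ + _)%N.
  exact: (leqW_mono size_triples3_mono).
rewrite -(subnKC le_dn) iotaD count_cat.
rewrite (eq_in_count (a2 := predT)); last by move=> e; rewrite mem_iota => /andP[].
rewrite (eq_in_count (a2 := pred0) (s := iota _ (n - d))); last first.
  by move=> e; rewrite mem_iota add0n => /andP[de _]; rewrite ltnNge de.
by rewrite count_predT count_pred0 size_iota addn0.
Qed.

Lemma eval_coefsP (p : {mpoly int[3]}) (x : frac3) (v : 'I_3 -> rat) :
  frac3_rep x v -> frac_rep (eval_coefs [seq int_code z | z <- coefs p] x) (ieval v p).
Proof.
move=> [x0 x1 x2]; rewrite /eval_coefs size_map size_map monomials3E size_map.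
rewrite degree_of_sizeE /coefs monomials3E -!map_comp ieval_triples3.
pose term (t : nat * (nat * nat)) : rat := (p@_(mono3 t))%:~R *
  (v ord0 ^+ t.1 * v (inord 1) ^+ t.2.1 * v (inord 2) ^+ t.2.2).
pose codes r := [seq int_code p@_(mono3 t) | t <- r].
suff gen r a q : frac_rep a q -> frac_rep (foldl (eval_step x) (a, codes r) r).1
    (q + \sum_(t <- r) term t).
  rewrite -[X in frac_rep _ X]add0r; apply: gen.
  by split; rewrite //= subr0 mul0r.
elim: r a q => [|t r IH] a q aq; first by rewrite big_nil addr0.
rewrite big_cons addrA; apply: IH; apply: frac_rep_add => //.
apply: frac_rep_mul; first exact: frac_rep_int.
by do 2?apply: frac_rep_mul; apply: frac_rep_exp.
Qed.

Definition instance_list (M : 'M[rat]_3) (s : 'cV[rat]_3) (p : {mpoly int[3]}) :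
    seq nat :=
  mx_code M ++ mx_code s ++ [seq int_code z | z <- coefs p].

Lemma enum_ord3 : enum 'I_3 = [:: ord0; inord 1; inord 2].
Proof.
apply: (inj_map val_inj); rewrite val_enum_ord /=.
by rewrite !inordK.
Qed.

Lemma mx_code33 (M : 'M[rat]_3) :
  mx_code M = rat_code (M ord0 ord0) ++ rat_code (M ord0 (inord 1)) ++
    rat_code (M ord0 (inord 2)) ++ rat_code (M (inord 1) ord0) ++
    rat_code (M (inord 1) (inord 1)) ++ rat_code (M (inord 1) (inord 2)) ++
    rat_code (M (inord 2) ord0) ++ rat_code (M (inord 2) (inord 1)) ++
    rat_code (M (inord 2) (inord 2)).
Proof. by rewrite /mx_code enum_ord3. Qed.

Lemma mx_code31 (s : 'cV[rat]_3) :
  mx_code s = rat_code (s ord0 0) ++ rat_code (s (inord 1) 0) ++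
    rat_code (s (inord 2) 0).
Proof.
have enum1 : enum 'I_1 = [:: 0].
  by apply: (inj_map val_inj); rewrite val_enum_ord.
by rewrite /mx_code enum_ord3 enum1.
Qed.

Lemma orbitP M s p n :
  frac3_rep (orbit (instance_list M s p) n) (fun k => (M ^+ n *m s) k 0).
Proof.
have e1 : lift ord0 ord0 = inord 1 :> 'I_3 by apply: val_inj; rewrite /= inordK.
have e2 : lift ord0 (lift ord0 ord0) = inord 2 :> 'I_3.
  by apply: val_inj; rewrite /= inordK.
elim: n => [|n [IH0 IH1 IH2]].
  rewrite expr0 mul1mx /orbit /= /instance_list mx_code33 mx_code31.
  by split; exact: frac_rep_rat.
rewrite /orbit iterS -/(orbit _ n) exprS -mulmxE -mulmxA.
move: (orbit _ n) (M ^+ n *m s) IH0 IH1 IH2 => x v IH0 IH1 IH2.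
rewrite /instance_list mx_code33 mx_code31.
by split; rewrite mxE !big_ord_recl big_ord0 addr0 e1 e2; (apply: frac_rep_add;
  [|apply: frac_rep_add]); apply: frac_rep_mul => //; exact: frac_rep_rat.
Qed.

Lemma parity_testP r M s p i : let L := instance_list M s p in
  let q := ieval (fun k => (M ^+ (test_time (CodeSeq.code L) i) *m s) k 0) p in
  parity_test r L i = match r with Gt0 => 0 < q | Ge0 => 0 <= q end.
Proof.
move=> L q.
have rep : frac_rep (eval_coefs (iter 24 behead L)
    (orbit L (test_time (CodeSeq.code L) i))) q.
  have -> : iter 24 behead L = [seq int_code z | z <- coefs p].
    by rewrite /L /instance_list mx_code33 mx_code31.
  exact: eval_coefsP (orbitP M s p _).
by case: r; [exact: frac_rep_gt0 rep | exact: frac_rep_ge0 rep].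
Qed.

(** * The test exponent *)

Lemma leq_nat_bits n : (nat_bits n <= n.+1)%N.
Proof.
rewrite /nat_bits ltnS; case: n => [|n]; first by rewrite trunc_log0.
by apply: leq_trans _ (trunc_logP (isT : 1 < 2)%N _); rewrite // ltnW // ltn_expl.
Qed.

Lemma leq_int_code z : (`|z| <= int_code z)%N.
Proof. by case: z => n /=; lia. Qed.

Lemma leq_rat_code_bits q : (rat_bits q <= \sum_(a <- rat_code q) a.+2)%N.
Proof.
rewrite /rat_code !big_cons big_nil addn0 /rat_bits /int_bits.
have := leq_nat_bits `|numq q|; have := leq_nat_bits `|denq q|.
by have := leq_int_code (numq q); have := leq_int_code (denq q); lia.
Qed.

Lemma leq_mx_code_bits m n (A : 'M[rat]_(m, n)) :
  (mx_bits A <= \sum_(a <- mx_code A) a.+2)%N.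
Proof.
rewrite /mx_code big_flatten /= big_allpairs_dep /= big_enum /=.
apply: leq_sum => i _; rewrite big_enum /=; apply: leq_sum => j _.
exact: leq_rat_code_bits.
Qed.

(** The code of [a :: L] is $2^a(2c+1)$ with $c$ the code of [L], and $2^a \ge a+1$. *)
Lemma leq_sum_code (L : seq nat) : (\sum_(a <- L) a.+1 <= CodeSeq.code L)%N.
Proof.
elim: L => [|a L IH]; first by rewrite big_nil.
rewrite big_cons /= -muln2; have := ltn_expl a (isT : 1 < 2)%N.
by move: IH; move: (\sum_(_ <- _) _)%N (CodeSeq.code L) (2 ^ a)%N; nia.
Qed.

(** A listed number [a] accounts for at most $a+2 \le 2(a+1)$ bits, the origin of the factor 2 in
    [test_time]. *)
Lemma leq_instance_bits M s p :
  (instance_bits M s p <= 2 * CodeSeq.code (instance_list M s p))%N.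
Proof.
apply: (@leq_trans (\sum_(a <- instance_list M s p) a.+2)); last first.
  apply: (@leq_trans (2 * \sum_(a <- instance_list M s p) a.+1)); last first.
    by rewrite leq_mul2l leq_sum_code.
  by rewrite big_distrr /=; apply: leq_sum => a _; lia.
have p_bits : (mpoly_bits p <= \sum_(z <- coefs p) (int_code z).+2)%N.
  apply: leq_sum => z _; have := leq_nat_bits `|z|; have := leq_int_code z.
  by rewrite /int_bits; lia.
rewrite /instance_list !big_cat big_map /= /instance_bits.
by have := leq_mx_code_bits M; have := leq_mx_code_bits s; lia.
Qed.

(** * Signs over the rationals and over the reals *)

Lemma ieval_rmorph (R S : comNzRingType) (f : {rmorphism R -> S}) n
    (v : 'I_n -> R) (p : {mpoly int[n]}) :
  ieval (fun i => f (v i)) p = f (ieval v p).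
Proof.
rewrite /ieval /mmap rmorph_sum; apply: eq_bigr => m _.
rewrite rmorphM rmorph_int /mmap1 rmorph_prod; congr (_ * _).
by apply: eq_bigr => i _; rewrite rmorphXn.
Qed.

Lemma target_ieval (R : realType) (p : {mpoly int[3]}) r (x : 'cV[R]_3) :
  (x \in target R p r) =
  match r with Gt0 => 0 < Num.sg (ieval (fun i => x i 0) p)
             | Ge0 => 0 <= Num.sg (ieval (fun i => x i 0) p) end.
Proof. by rewrite inE meval_map_intr sgr_gt0 sgr_ge0. Qed.

(** The orbit is rational and [ratr] preserves order, so membership is decided in the rationals and
    the parity set is the same for every [R]. *)
Lemma target_rat (R : realType) (p : {mpoly int[3]}) r (x : 'cV[rat]_3) :
  (map_mx ratr x \in target R p r) =
  match r with Gt0 => 0 < ieval (fun i => x i 0) p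
             | Ge0 => 0 <= ieval (fun i => x i 0) p end.
Proof.
have -> : (map_mx ratr x \in target R p r) =
    match r with Gt0 => 0 < ratr (ieval (fun i => x i 0) p) :> R
               | Ge0 => 0 <= ratr (ieval (fun i => x i 0) p) :> R end.
  rewrite target_ieval sgr_gt0 sgr_ge0 -ieval_rmorph.
  by rewrite (eq_ieval (w := fun i => ratr (x i 0)) p) // => i; rewrite mxE.
by rewrite ltr0q ler0q.
Qed.

Theorem theorem12 :
  exists c : nat, forall r : sign_cond,
  exists2 X : 'M[rat]_3 -> 'cV[rat]_3 -> {mpoly int[3]} -> {set 'I_2},
    computable X &
    forall (R : realType) (M : 'M[rat]_3) (s : 'cV[rat]_3) (p : {mpoly int[3]}),
      three_real_eigenvalues R M ->
      exists2 N : nat, (N <= 2 ^ (instance_bits M s p ^ c))%N &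
        forall n : nat, (N < n)%N ->
          (map_mx ratr (M ^+ n *m s) \in target R p r) <->
          (inord (n %% 2) \in X M s p).
Proof.
(* The stability bound $2^{I^7}$ concerns half the exponent; one further power of [I] covers the
   doubling. *)
exists 8%N => r; exists (fun M s p => parities r (instance_list M s p)).
  have [f rf fE] := parities_computable r.
  by exists f => // M s p; rewrite -fE.
move=> R M s p [l lE]; set I := instance_bits M s p.
exists (2 ^ I ^ 8)%N => // n lt_n.
pose i := (n %% 2)%N; have i1 : (i <= 1)%N by rewrite -ltnS ltn_mod.
have [b bP] := sign_stable_class s p lE i1.
have I27 : (27 <= I)%N by rewrite /I /instance_bits; have := leq_mx_bits3 M; lia.
pose n' := test_time (CodeSeq.code (instance_list M s p)) i.
have n_m : n = (2 * (n %/ 2) + i)%N by rewrite mulnC -divn_eq.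
have le_m : (2 ^ I ^ 7 <= n %/ 2)%N.
  have : (2 * 2 ^ I ^ 7 <= 2 ^ I ^ 8)%N.
    rewrite -expnS leq_pexp2l // expnS.
    by have : (0 < I ^ 7)%N; [rewrite expn_gt0; lia | nia].
  by move: n_m lt_n i1; move: (_ ^ _ ^ 7)%N (_ ^ _ ^ 8)%N (n %/ 2)%N; lia.
have le_m' : (2 ^ I ^ 7 <= 2 ^ (2 * CodeSeq.code (instance_list M s p)) ^ 7)%N.
  by rewrite leq_pexp2l // leq_exp2r // leq_instance_bits.
(* [n] and [n'] have the same parity and both lie past the bound, so [p] has the same sign at
   both. *)
have -> : (map_mx ratr (M ^+ n *m s) \in target R p r) =
          (map_mx ratr (M ^+ n' *m s) \in target R p r).
  by rewrite !target_ieval {1 2}n_m (bP _ le_m) (bP _ le_m').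
by rewrite target_rat inE inordK ?ltn_mod // parity_testP.
Qed.
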